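(* Consider the SAFE distributed field estimator, under the measurement, attack and communication models and standing assumptions given in the context. Let $\mathcal{A}=\{p_1,\dots,p_{|\mathcal{A}|}\}$ be the set of compromised measurement streams, $\mathcal{N}=\mathcal{P}\setminus\mathcal{A}$, $\mathcal{H}_{\mathcal{A}}=[\,h_{p_1}\ \cdots\ h_{p_{|\mathcal{A}|}}\,]^\intercal$, $\mathcal{G}_{\mathcal{N}}=\sum_{p\in\mathcal{N}}h_ph_p^\intercal$, and $$\Delta_{\mathcal{A}}=\max_{v\in\mathbb{R}^{|\mathcal{A}|},\ \|v\|_\infty\le 1}\left\|\mathcal{H}_{\mathcal{A}}^\intercal v\right\|_2 .$$ If $$\lambda_{\min}(\mathcal{G}_{\mathcal{N}})>\Delta_{\mathcal{A}},$$ then for all agents $n\in\{1,\dots,N\}$ and all $0\le\tau_0<\min\left(\tau_\gamma,\tfrac12-\tau_\gamma\right)$, $$\mathbb{P}\left(\lim_{t\to\infty}(t+1)^{\tau_0}\left\|x_n(t)-\theta^*_{\mathcal{I}_n}\right\|_2=0\right)=1,$$ where $\theta^*_{\mathcal{I}_n}\in\mathbb{R}^{|\mathcal{I}_n|}$ is defined by $[\theta^*_{\mathcal{I}_n}]_i=[\theta^*]_{\mathcal{I}_n(i)}$ for $i=1,\dots,|\mathcal{I}_n|$.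
   Context: **Measurements and attacks.** $\theta^*\in\mathbb{R}^M$ is an unknown, static parameter. There are $N$ agents. At each time $t=0,1,2,\dots$ agent $n$ obtains $y_n(t)=H_n\theta^*+w_n(t)+a_n(t)\in\mathbb{R}^{P_n}$, where $H_n\in\mathbb{R}^{P_n\times M}$ is known, $w_n(t)$ is noise and $a_n(t)$ is an attack. The noise $w_n(t)$ is i.i.d. in time, with zero mean and (finite) covariance $\Sigma_n$, and independent across agents. Let $P=\sum_nP_n$, $\overline{P}_n=\sum_{j=1}^{n-1}P_j$. Scalar measurement streams are indexed by $p\in\mathcal{P}=\{1,\dots,P\}$ by stacking agents in order: the components of $y_n(t)$ (and likewise of $w_n(t)$, $a_n(t)$) are the scalars $y^{(p)}(t)$ with $p=\overline{P}_n+1,\dots,\overline{P}_n+P_n$. The stacked matrix $[H_1^\intercal\cdots H_N^\intercal]^\intercal$ has rows $h_1^\intercal,\dots,h_P^\intercal$, with $\|h_p\|_2=1$ for all $p$. The set of all streams is globally observable: $\sum_{p\in\mathcal{P}}h_ph_p^\intercal$ is invertible. The compromised streams are $\mathcal{A}=\{p\in\mathcal{P}: a^{(p)}(t)\ne0\text{ for some }t\}$, a fixed set with $0\le|\mathcal{A}|<P$. Apart from this, attacks are arbitrary (deterministic or random, with no assumption on their distribution or statistics). **Interest sets.** Each agent $n$ has an interest set $\mathcal{I}_n\subseteq\{1,\dots,M\}$, ordered increasingly. $\mathcal{I}_n(r)$ is its $r$-th element, and $\mathcal{I}_n^{-1}(m)=r$ means $\mathcal{I}_n(r)=m$. The physical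 coupling set $\{m: H_ne_m\neq0\}$ (indices of nonzero columns of $H_n$) is contained in $\mathcal{I}_n$. Let $\mathcal{J}_m=\{n: m\in\mathcal{I}_n\}$, and $|\mathcal{J}_m|>0$ for all $m=1,\dots,M$. **Communication.** At time $t$ the agents communicate over a random simple undirected graph $G(t)$ on $\{1,\dots,N\}$, with Laplacian $L(t)$ and neighborhoods $\Omega_n(t)$. The sequence $\{L(t)\}$ is i.i.d. and independent of the noises. With $G_m(t)$ the subgraph of $G(t)$ induced by $\mathcal{J}_m$, $L_m(t)$ its Laplacian and $\overline{L}_m=\mathbb{E}[L_m(t)]$, one has $\lambda_2(\overline{L}_m)>0$ (second smallest eigenvalue) for every $m=1,\dots,M$. All random objects live on a common probability space. **SAFE algorithm.** Agent $n$ keeps an estimate $x_n(t)\in\mathbb{R}^{|\mathcal{I}_n|}$, with $x_n(0)=0$. At each time $t$ it receives $x_l(t)$ from each $l\in\Omega_n(t)$ and forms $x^c_{l,n}(t),x^p_{l,n}(t)\in\mathbb{R}^{|\mathcal{I}_n|}$: if $\mathcal{I}_n(i)\in\mathcal{I}_l$ then $[x^c_{l,n}(t)]_i=[x_l(t)]_{\mathcal{I}_l^{-1}(\mathcal{I}_n(i))}$ and $[x^p_{l,n}(t)]_i=[x_n(t)]_i$; otherwise both are $0$. The time-averaged measurement is $\overline{y}_n(t)=\frac{1}{t+1}\sum_{j=0}^ty_n(j)$, with scalar components $\overline{y}^{(p)}(t)$. $H_n^c$ is $H_n$ with the columns whose indices are not in $\mathcal{I}_n$ removed, and $(h_p^c)^\intercal$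 is its row corresponding to stream $p$. The update is $$x_n(t+1)=x_n(t)-\beta_t\sum_{l\in\Omega_n(t)}\left(x^p_{l,n}(t)-x^c_{l,n}(t)\right)+\alpha_t(H_n^c)^\intercal K_n(t)\left(\overline{y}_n(t)-H_n^cx_n(t)\right),$$ $K_n(t)=\mathrm{diag}(k_{\overline{P}_n+1}(t),\dots,k_{\overline{P}_n+P_n}(t))$, $k_p(t)=\min\left(1,\gamma_t\,|\overline{y}^{(p)}(t)-(h_p^c)^\intercal x_n(t)|^{-1}\right)$ (equal to $1$ when the innovation is $0$). The weights are $\alpha_t=a(t+1)^{-\tau_1}$, $\beta_t=b(t+1)^{-\tau_2}$, $\gamma_t=\Gamma(t+1)^{-\tau_\gamma}$ with $a,b,\Gamma>0$, $0<\tau_2<\tau_1<1$, $0<\tau_\gamma<\min\left(\tfrac12,\tau_1-\tau_2,1-\tau_1\right)$. *)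

(* Defs.v *)
From HB Require Import structures.
From mathcomp Require Import all_boot all_order all_algebra.
From mathcomp Require Import finmap.
From mathcomp Require Import all_classical all_reals all_analysis.

Set Implicit Arguments.
Unset Strict Implicit.
Unset Printing Implicit Defensive.

Import Order.TTheory GRing.Theory Num.Theory.
Import numFieldNormedType.Exports.

Local Open Scope classical_set_scope.
Local Open Scope ring_scope.

(* Borel sets of matrices: the sigma-algebra generated by the entries. *)

Definition mx_display : measure_display.
Proof. exact: default_measure_display. Qed.

Section matrix_measurable.
Context {R : realType} (m n : nat).

Definition mx_salgebra : set (set 'M[R]_(m, n)) :=
  <<s \bigcup_(ij in [set: 'I_m * 'I_n])
        preimage_set_system setT (fun A : 'M[R]_(m, n) => A ij.1 ij.2)
          measurable >>.

Let mx_salgebra0 : mx_salgebra set0.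
Proof. exact: sigma_algebra0. Qed.

Let mx_salgebraC A : mx_salgebra A -> mx_salgebra (~` A).
Proof. exact: sigma_algebraC. Qed.

Let mx_salgebra_bigcup (F : (set 'M[R]_(m, n))^nat) :
  (forall i, mx_salgebra (F i)) -> mx_salgebra (\bigcup_i F i).
Proof. exact: sigma_algebra_bigcup. Qed.

HB.instance Definition _ := @isMeasurable.Build mx_display 'M[R]_(m, n)
  mx_salgebra mx_salgebra0 mx_salgebraC mx_salgebra_bigcup.

End matrix_measurable.

Section independence.
Context {R : realType} {d : measure_display} {Omega : measurableType d}.
Variable P : probability Omega R.

Definition mutually_independent (I : choiceType) (F : I -> set (set Omega)) :=
  forall (J : {fset I}) (A : I -> set Omega),
    (forall i, i \in J -> F i (A i)) ->
    P (\bigcap_(i in [set` J]) A i) = (\prod_(i <- J) P (A i))%E.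

Definition independent2 (F G : set (set Omega)) :=
  forall A B, F A -> G B -> P (A `&` B) = (P A * P B)%E.

Context {d' : measure_display} {E : measurableType d'}.

Definition salgebra_of (X : Omega -> E) : set (set Omega) :=
  preimage_set_system setT X measurable.

Definition salgebra_of_process (X : nat -> Omega -> E) : set (set Omega) :=
  <<s \bigcup_t salgebra_of (X t) >>.

Definition iid (X : nat -> Omega -> E) :=
  mutually_independent (fun t => salgebra_of (X t)) /\
  forall t (B : set E), measurable B -> P (X t @^-1` B) = P (X 0%N @^-1` B).

End independence.

Section linear_algebra.
Context {R : realType}.

(* The library norm of a matrix is the sup norm, hence a Euclidean norm here. *)
Definition norm2 k (v : 'cV[R]_k) : R := Num.sqrt (\sum_(i < k) v i ord0 ^+ 2).

(* The eigenvalues of A with multiplicity, in nondecreasing order, when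
   char_poly A splits over R (e.g., when A is symmetric); [::] otherwise. *)
Definition spectrum k (A : 'M[R]_k) : seq R :=
  xget [::] [set s : seq R | sorted <=%R s /\
                             char_poly A = \prod_(x <- s) ('X - x%:P)].

Definition lambda_min k (A : 'M[R]_k) : R := nth 0 (spectrum A) 0.

(* The second smallest eigenvalue; it does not exist for k <= 1, where a graph
   Laplacian imposes no connectivity condition. *)
Definition lambda2 k (A : 'M[R]_k) : R := nth 0 (spectrum A) 1.

Definition laplacian k (e : rel 'I_k) : 'M[R]_k :=
  \matrix_(i, j) (if i == j then #|e i|%:R else - (e i j)%:R).

End linear_algebra.

Section expectation_matrix.
Context {R : realType} {d : measure_display} {Omega : measurableType d}.
Variable P : probability Omega R.

Definition expectation_mx m n (X : Omega -> 'M[R]_(m, n)) : 'M[R]_(m, n) :=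
  \matrix_(i, j) fine 'E_P[fun omega => X omega i j]%E.

End expectation_matrix.

(* Since enum_val lists a set of ordinals in increasing order, the r-th element
   of the interest set I n is enum_val r for r : 'I_#|I n|. *)
Section interest_sets.
Context {R : realType} {N M : nat}.
Variable I : 'I_N -> {set 'I_M}.

Definition interest_inv n (m : 'I_M) : option 'I_#|I n| :=
  [pick r | enum_val r == m].

Definition interested (m : 'I_M) : {set 'I_N} := [set n | m \in I n]%SET.

Definition interest_vec n (v : 'cV[R]_M) : 'cV[R]_#|I n| :=
  \col_r v (enum_val r) ord0.

Definition interest_cols n k (A : 'M[R]_(k, M)) : 'M[R]_(k, #|I n|) :=
  mxsub id (fun r : 'I_#|I n| => enum_val r) A.

Definition induced_laplacian (e : rel 'I_N) (m : 'I_M) :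
    'M[R]_#|interested m| :=
  laplacian (fun i j : 'I_#|interested m| => e (enum_val i) (enum_val j)).

End interest_sets.

(* A stream is an index of the stacked matrix or vector \mxcol_n; this stacks
   the agents in increasing order. *)
Section streams.
Context {R : realType} {N M : nat} {Pd : 'I_N -> nat}.
Local Notation stream := 'I_(\sum_(n < N) Pd n).
Variable H : forall n : 'I_N, 'M[R]_(Pd n, M).

Definition stacked : 'M[R]_(\sum_(n < N) Pd n, M) := \mxcol_n H n.

Definition stream_vec (p : stream) : 'cV[R]_M := (row p stacked)^T.

Definition gramian (S : {set stream}) : 'M[R]_M :=
  \sum_(p in S) stream_vec p *m (stream_vec p)^T.

Definition attacked_mx (A : {set stream}) : 'M[R]_(#|A|, M) :=
  \matrix_(i < #|A|) (stream_vec (enum_val i))^T.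

(* `|v| is the sup norm of v; the supremum is a maximum by compactness. *)
Definition Delta (A : {set stream}) : R :=
  sup [set norm2 ((attacked_mx A)^T *m v) |
        v in [set v : 'cV[R]_#|A| | `|v| <= 1]].

Definition compromised (a : forall n, nat -> 'cV[R]_(Pd n)) : {set stream} :=
  [set p | `[< exists t, (\mxcol_n a n t) p ord0 != 0 >]]%SET.

End streams.

(* One sample path of the estimator, driven by the measurements y and the
   communication graphs G. *)
Section safe.
Context {R : realType} {N M : nat} {Pd : 'I_N -> nat}.
Variables (I : 'I_N -> {set 'I_M}) (H : forall n : 'I_N, 'M[R]_(Pd n, M)).
Variables (alpha beta gamma : nat -> R).
Variables (y : forall n : 'I_N, nat -> 'cV[R]_(Pd n)) (G : nat -> rel 'I_N).

Definition time_average n (t : nat) : 'cV[R]_(Pd n) :=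
  t.+1%:R^-1 *: \sum_(j < t.+1) y n j.

Definition censored l n (xl : 'cV[R]_#|I l|) : 'cV[R]_#|I n| :=
  \col_i (if interest_inv I l (enum_val i) is Some r then xl r ord0 else 0).

Definition processed l n (xn : 'cV[R]_#|I n|) : 'cV[R]_#|I n| :=
  \col_i (if enum_val i \in I l then xn i ord0 else 0).

Definition gain (g innov : R) : R :=
  if innov == 0 then 1 else Num.min 1 (g * `|innov|^-1).

Definition gain_mx k (g : R) (innov : 'cV[R]_k) : 'M[R]_k :=
  diag_mx (\row_i gain g (innov i ord0)).

Definition safe_step (t : nat) (x : forall n, 'cV[R]_#|I n|) n :
    'cV[R]_#|I n| :=
  let Hc := interest_cols I n (H n) in
  let innov := time_average n t - Hc *m x n in
  x n - beta t *: (\sum_(l | G t n l) (processed l (x n) - censored n (x l)))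
      + alpha t *: (Hc^T *m gain_mx (gamma t) innov *m innov).

Fixpoint safe (t : nat) : forall n, 'cV[R]_#|I n| :=
  if t is t'.+1 then safe_step t' (safe t') else fun=> 0.

End safe.

(* c (t + 1)^(- tau) *)
Definition decaying {R : realType} (c tau : R) (t : nat) : R :=
  c * t.+1%:R `^ (- tau).

(* Main.v *)
(* For a field component m, the average of its estimates over the agents
   interested in it is untouched by the consensus term, Laplacians being
   symmetric.  The deviations from that average contract: an edge of positive
   probability almost surely occurs in every window of O(log t) steps before a
   large t, and over such a window the disagreement shrinks by a factor
   1 - c beta_t, whatever the perturbation, by the Poincare inequality of the
   mean Laplacian.  The perturbation is at most alpha_t gamma_t times a
   constant, for any attack, because the gains saturate the innovations; hence
   the disagreement is o(gamma_t).  No independence between attacks and graphs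
   is used, as the contraction holds path by path.  A second moment bound on
   dyadic blocks of noise shows that the averaged noise is o(gamma_t) too.

   It remains to follow the averaged error e with the Lyapunov function
   sum_m |J_m| e_m^2.  While |e| >= gamma_t, the uncompromised streams
   decrease it at rate almost lambda_min(G_N) alpha_t gamma_t |e|, and the
   compromised ones increase it at rate at most
   Delta_A alpha_t gamma_t |e|.  As sum_t alpha_t gamma_t diverges, |e| reaches
   the order of gamma_t, and it stays there because gamma_t decreases slowly.
   So every estimate is within O(gamma_t) of its target. *)
Require Import Defs.
From HB Require Import structures.
From mathcomp Require Import all_boot all_order all_algebra.
From mathcomp Require Import finmap.
From mathcomp Require Import all_classical all_reals all_analysis.
From mathcomp Require Import measurable_realfun.
From mathcomp Require Import ring lra zify.
Set Implicit Arguments.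
Unset Strict Implicit.
Unset Printing Implicit Defensive.
Import Order.TTheory GRing.Theory Num.Theory.
Import numFieldNormedType.Exports.
Local Open Scope classical_set_scope.
Local Open Scope ring_scope.

(** * Euclidean norm *)

(** An attack may depend on the noise and on all graphs, past and future, so conditioning on the
    past gives no drift to work with. Randomness is therefore confined to two almost sure facts, the
    recurrence of edges and the rate of the averaged noise; [resilient_path] then treats a single
    sample path, on which the readings of the compromised streams are unrestricted.

    A window length T_t of order log t meets two demands: missing an edge has probability at most (t
    + 1)^-2, and the state barely moves, since T_t beta_t tends to 0. Per window the disagreement
    loses a fraction of order beta_t and gains at most the order of T_t alpha_t gamma_t; it settles
    at T_t alpha_t gamma_t / beta_t, which is o(gamma_t) because tau2 < tau1.

    As [spectrum] is read off the characteristic polynomial, eigenvalue hypotheses must first become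
    inequalities between quadratic forms. For [lambda_min], the best constant of a Rayleigh bound is
    shown to be an eigenvalue; for [lambda2], a second null direction of the mean Laplacian would
    make 0 a multiple root. *)

Section l2_norm.
Context {R : rcfType} {T : finType}.
Implicit Types u v : T -> R.

Lemma sum_sqr_ge0 u : 0 <= \sum_i u i ^+ 2.
Proof. by apply: sumr_ge0 => i _; exact: sqr_ge0. Qed.

Lemma sum_mul_sqr_le u v :
  (\sum_i u i * v i) ^+ 2 <= (\sum_i u i ^+ 2) * (\sum_i v i ^+ 2).
Proof.
(* Lagrange's identity *)
have : 0 <= \sum_i \sum_j (u i * v j - u j * v i) ^+ 2.
  by apply: sumr_ge0 => i _; apply: sumr_ge0 => j _; exact: sqr_ge0.
have -> : \sum_i \sum_j (u i * v j - u j * v i) ^+ 2 =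
    \sum_i \sum_j (u i ^+ 2 * v j ^+ 2 + v i ^+ 2 * u j ^+ 2
                   + (u i * v i) * (u j * v j) * (- 2)).
  by apply: eq_bigr => i _; apply: eq_bigr => j _; ring.
under eq_bigr do rewrite !big_split/= -!mulr_sumr -mulr_suml -mulr_sumr.
rewrite !big_split/= -!mulr_suml; lra.
Qed.

(* [norm2 v] is convertible to [l2 (fun i => v i ord0)]. *)
Definition l2 u : R := Num.sqrt (\sum_i u i ^+ 2).

Lemma l2_ge0 u : 0 <= l2 u. Proof. exact: sqrtr_ge0. Qed.

Lemma sqr_l2 u : l2 u ^+ 2 = \sum_i u i ^+ 2.
Proof. by rewrite sqr_sqrtr// sum_sqr_ge0. Qed.

Lemma eq_l2 u v : u =1 v -> l2 u = l2 v.
Proof. by move=> uv; congr Num.sqrt; apply: eq_bigr => i _; rewrite uv. Qed.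

Lemma normr_le_l2 u i : `|u i| <= l2 u.
Proof.
rewrite -(@ler_pXn2r _ 2) ?nnegrE ?l2_ge0//.
rewrite sqr_l2 real_normK ?num_real// (bigD1 i)//= lerDl.
by apply: sumr_ge0 => j _; exact: sqr_ge0.
Qed.

Lemma dot_le_l2 u v : `|\sum_i u i * v i| <= l2 u * l2 v.
Proof.
rewrite -(@ler_pXn2r _ 2) ?nnegrE ?mulr_ge0 ?l2_ge0//.
by rewrite real_normK ?num_real// exprMn !sqr_l2 sum_mul_sqr_le.
Qed.

Lemma l2_triangle u v : l2 (fun i => u i + v i) <= l2 u + l2 v.
Proof.
rewrite -(@ler_pXn2r _ 2) ?nnegrE ?addr_ge0 ?l2_ge0//.
rewrite sqr_l2 sqrrD !sqr_l2.
have := le_trans (ler_norm _) (dot_le_l2 u v).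
have -> : \sum_i (u i + v i) ^+ 2 =
    \sum_i u i ^+ 2 + 2 * \sum_i u i * v i + \sum_i v i ^+ 2.
  by rewrite mulr_sumr -!big_split/=; apply: eq_bigr => i _; ring.
rewrite -mulr_natl; lra.
Qed.

Lemma l2_scale (c : R) u : 0 <= c -> l2 (fun i => c * u i) = c * l2 u.
Proof.
move=> c0; rewrite /l2; under eq_bigr do rewrite exprMn.
by rewrite -mulr_sumr sqrtrM ?sqr_ge0// sqrtr_sqr ger0_norm.
Qed.

Lemma l2_le_l1 u : l2 u <= \sum_i `|u i|.
Proof.
have s0 : 0 <= \sum_i `|u i| by apply: sumr_ge0.
rewrite -(@ler_pXn2r _ 2) ?nnegrE ?l2_ge0// sqr_l2 expr2 mulr_sumr.
apply: ler_sum => i _; rewrite -(real_normK (num_real (u i))) expr2.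
by rewrite ler_wpM2r// (bigD1 i)//= lerDl sumr_ge0.
Qed.

Lemma l2_le_max u (B : R) : (forall i, `|u i| <= B) -> l2 u <= #|T|%:R * B.
Proof.
move=> uB; apply: (le_trans (l2_le_l1 u)).
apply: le_trans (_ : \sum_(i : T) B <= _); first exact: ler_sum.
by rewrite sumr_const mulr_natl.
Qed.

Lemma sqr_sum_le u : (\sum_i u i) ^+ 2 <= #|T|%:R * \sum_i u i ^+ 2.
Proof.
have := sum_mul_sqr_le u (fun=> 1).
under eq_bigr do rewrite mulr1.
by rewrite expr1n sumr_const mulrC.
Qed.

Lemma sum_sqr_eq0 u : \sum_i u i ^+ 2 = 0 -> forall i, u i = 0.
Proof.
move=> /eqP; rewrite psumr_eq0; last by move=> i _; exact: sqr_ge0.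
by move=> /allP u0 i; apply/eqP; have := u0 i (mem_index_enum i); rewrite sqrf_eq0.
Qed.

End l2_norm.

(** * Quadratic forms and spectra *)

Section char_poly_kernel.
Context {F : fieldType} {n : nat}.

(** The algebraic multiplicity of 0 is at least its geometric one, [n - \rank A]. In
    [lambda2_poincare], two independent null vectors thus make 0 a double root. *)
Lemma dvdp_Xn_char_poly (A : 'M[F]_n) : 'X^(n - \rank A) %| char_poly A.
Proof.
pose C := col_ebase A; pose W := row_ebase A.
have Cu : C \in unitmx by exact: col_ebase_unit.
have Wu : W \in unitmx by exact: row_ebase_unit.
pose V := invmx C *m invmx W.
(* With [A = C *m pid_mx r *m W], the columns of ['X *: V - pid_mx r] past the
   [r] first ones are divisible by ['X]. *)
have cpE : char_poly A = (\det C)%:P *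
    \det ('X *: map_mx polyC V - map_mx polyC (pid_mx (\rank A))) *
    (\det W)%:P.
  rewrite /char_poly -!(det_map_mx polyC) -!det_mulmx; congr (\det _).
  rewrite mulmxBr mulmxBl -scalemxAr -scalemxAl -!map_mxM.
  have -> : C *m V *m W = 1%:M by rewrite /V mulmxA mulmxV// mul1mx mulVmx.
  rewrite [C *m _ *m W]mulmx_ebase /char_poly_mx; congr (_ - _).
  by rewrite map_mx1 scalemx1.
pose D : 'rV[{poly F}]_n := \row_j (if (j < \rank A)%N then 1 else 'X).
pose N : 'M[{poly F}]_n := \matrix_(i, j)
  (if (j < \rank A)%N then 'X * (V i j)%:P - (pid_mx (\rank A) i j : F)%:P
   else (V i j)%:P).
have NE : 'X *: map_mx polyC V - map_mx polyC (pid_mx (\rank A)) =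
    N *m diag_mx D.
  apply/matrixP => i j; rewrite mul_mx_diag !mxE.
  case: ifPn => jr; first by rewrite mulr1.
  case: eqP => [ij|_]; last by rewrite /= subr0 mulrC.
  by rewrite ij (negbTE jr) /= subr0 mulrC.
rewrite cpE NE det_mulmx det_diag.
have -> : \prod_(j < n) D 0 j = 'X^(n - \rank A).
  under eq_bigr do rewrite mxE.
  rewrite -(big_mkord xpredT (fun j => if (j < \rank A)%N then 1 else 'X)).
  rewrite (@big_cat_nat _ _ _ (\rank A))//= ?rank_leq_row//.
  rewrite big_nat big1 ?mul1r; last by move=> j /andP[_ ->].
  rewrite big_nat (eq_bigr (fun=> 'X)); last first.
    by move=> j /andP[/leq_gtF ->].
  by rewrite -big_nat prodr_const_nat.
by rewrite dvdp_mulr// dvdp_mull// dvdp_mull.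
Qed.

End char_poly_kernel.

Section quadratic_forms.
Context {R : realType} {n : nat}.
Implicit Types (A B : 'M[R]_n) (u v w : 'cV[R]_n).

Definition bform A u v : R := (u^T *m A *m v) 0 0.

Lemma bformDl A u v w : bform A (u + v) w = bform A u w + bform A v w.
Proof. by rewrite /bform linearD/= !mulmxDl mxE. Qed.

Lemma bformDr A u v w : bform A w (u + v) = bform A w u + bform A w v.
Proof. by rewrite /bform mulmxDr mxE. Qed.

Lemma bformZl A c u w : bform A (c *: u) w = c * bform A u w.
Proof. by rewrite /bform linearZ/= -!scalemxAl mxE. Qed.

Lemma bformZr A c u w : bform A w (c *: u) = c * bform A w u.
Proof. by rewrite /bform -scalemxAr mxE. Qed.

Lemma bformDm A B u v : bform (A + B) u v = bform A u v + bform B u v.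
Proof. by rewrite /bform mulmxDr mulmxDl mxE. Qed.

Lemma bformC A u v : A^T = A -> bform A u v = bform A v u.
Proof.
move=> sA; rewrite /bform; transitivity ((u^T *m A *m v)^T 0 0).
  by rewrite [RHS]mxE.
by rewrite !trmx_mul trmxK sA mulmxA.
Qed.

Lemma bformE A u v : bform A u v = \sum_i \sum_j u i 0 * A i j * v j 0.
Proof.
rewrite /bform !mxE exchange_big/=; apply: eq_bigr => i _.
by rewrite !mxE mulr_suml; apply: eq_bigr => j _; rewrite !mxE.
Qed.

Lemma bform1 u v : bform 1%:M u v = \sum_i u i 0 * v i 0.
Proof. by rewrite /bform mulmx1 !mxE; apply: eq_bigr => i _; rewrite mxE. Qed.

Lemma bform1_ge0 v : 0 <= bform 1%:M v v.
Proof. by rewrite bform1; apply: sumr_ge0 => i _; rewrite -expr2 sqr_ge0. Qed.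

Lemma bform1_eq0 v : (bform 1%:M v v == 0) = (v == 0).
Proof.
rewrite bform1; apply/eqP/eqP => [|->]; last first.
  by rewrite big1// => i _; rewrite mxE mul0r.
under eq_bigr do rewrite -expr2.
by move=> v0; apply/matrixP => i j; rewrite ord1 mxE (sum_sqr_eq0 v0).
Qed.

Lemma bform_bound A :
  exists2 K : R, 0 < K & forall v, `|bform A v v| <= K * bform 1%:M v v.
Proof.
exists (1 + \sum_i \sum_j `|A i j|) => [|v].
  by rewrite ltr_pwDl// sumr_ge0// => i _; rewrite sumr_ge0.
apply: le_trans (_ : (\sum_i \sum_j `|A i j|) * bform 1%:M v v <= _); last first.
  by rewrite ler_wpM2r ?bform1_ge0// lerDr.
rewrite bformE mulr_suml; apply: (le_trans (ler_norm_sum _ _ _)).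
apply: ler_sum => i _; rewrite mulr_suml; apply: (le_trans (ler_norm_sum _ _ _)).
apply: ler_sum => j _; rewrite !normrM mulrAC mulrC ler_wpM2l//.
rewrite bform1; under eq_bigr do rewrite -expr2.
rewrite -(sqr_l2 (fun i => v i 0)) expr2.
by rewrite ler_pM// (normr_le_l2 (fun i => v i 0)).
Qed.

Lemma psd_cauchy A u v : A^T = A -> (forall w, 0 <= bform A w w) ->
  bform A u v ^+ 2 <= bform A u u * bform A v v.
Proof.
move=> sA A0; set a := bform A u u; set b := bform A u v; set c := bform A v v.
have q (s t : R) : 0 <= s ^+ 2 * a + 2 * s * t * b + t ^+ 2 * c.
  have := A0 (s *: u + t *: v).
  rewrite !(bformDl, bformDr, bformZl, bformZr) (bformC v u sA) -/a -/b -/c.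
  by congr (_ <= _); ring.
have a0 : 0 <= a by exact: A0.
have c0 : 0 <= c by exact: A0.
(* The discriminant argument fails at [c = 0]; there the form is affine in [t], and a nonzero [b]
   would let it reach [- a - 2], which is negative. *)
have [c_eq0|c_neq0] := eqVneq c 0.
  have [->|b0] := eqVneq b 0; first by rewrite expr0n mulr_ge0.
  have := q 1 (- (a + 1) / b); rewrite c_eq0.
  have -> : 1 ^+ 2 * a + 2 * 1 * (- (a + 1) / b) * b +
      (- (a + 1) / b) ^+ 2 * 0 = - a - 2 by field.
  lra.
have cp : 0 < c by rewrite lt0r c_neq0.
have := q c (- b); have -> : c ^+ 2 * a + 2 * c * - b * b + (- b) ^+ 2 * c
  = c * (a * c - b ^+ 2) by ring.
by rewrite pmulr_rge0// subr_ge0.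
Qed.

(** Cauchy-Schwarz for the form [A], applied to [v] and [A^-1 v], gives |v|^4 <= A(v, v) A^-1(v, v),
    and the last factor is at most K |v|^2. No diagonalisation is involved. *)
Lemma psd_unit_coercive A : A^T = A -> (forall w, 0 <= bform A w w) ->
  A \in unitmx ->
  exists2 c : R, 0 < c & forall v, c * bform 1%:M v v <= bform A v v.
Proof.
move=> sA A0 uA; have [K K0 hK] := bform_bound (invmx A).
exists K^-1; first by rewrite invr_gt0.
move=> v; rewrite ler_pdivrMl//.
have [->|v0] := eqVneq v 0.
  by rewrite /bform !mulmx0 mxE mulr0.
have vp : 0 < bform 1%:M v v by rewrite lt0r bform1_eq0 v0 bform1_ge0.
have := psd_cauchy v (invmx A *m v) sA A0.
have -> : bform A v (invmx A *m v) = bform 1%:M v v.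
  by rewrite /bform mulmx1 mulmxA mulmxK.
have -> : bform A (invmx A *m v) (invmx A *m v) = bform (invmx A) v v.
  by rewrite /bform trmx_mul trmx_inv sA !mulmxA mulmxKV.
move=> h; rewrite -(ler_pM2r vp) -expr2; apply: (le_trans h).
rewrite [K * _]mulrC -mulrA ler_wpM2l//.
by apply: le_trans (hK v); exact: ler_norm.
Qed.

(** The largest [c] such that [A - c] is positive semidefinite is an eigenvalue: were [A - c]
    invertible, it would be coercive and [c] could be increased. So the supremum of [S] is a root of
    the characteristic polynomial, hence at least [rho]. *)
Lemma rayleigh_ge A (rho : R) : A^T = A ->
  (forall mu, root (char_poly A) mu -> rho <= mu) ->
  forall v, rho * bform 1%:M v v <= bform A v v.
Proof.
move=> sA hrho v.
have [->|v0] := eqVneq v 0; first by rewrite /bform !mulmx0 mxE mulr0.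
pose S := [set c : R | forall w, c * bform 1%:M w w <= bform A w w].
have [K K0 hK] := bform_bound A.
have SK : S (- K).
  move=> w; have := hK w; rewrite ler_norml => /andP[+ _].
  by rewrite mulNr.
have Sub w : w != 0 -> ubound S (bform A w w / bform 1%:M w w).
  move=> w0 c /(_ w); rewrite ler_pdivlMr//.
  by rewrite lt0r bform1_eq0 w0 bform1_ge0.
have supS : has_sup S by split; [exists (- K)|exists (bform A v v / bform 1%:M v v); exact: Sub].
have bB w c : bform (A - c%:M) w w = bform A w w - c * bform 1%:M w w.
  rewrite /bform mulmxBr mulmxBl mxE; congr (_ + _).
  by rewrite mxE -[c%:M]scalemx1 -scalemxAr -scalemxAl [in LHS]mxE.
have sB : (A - (sup S)%:M)^T = A - (sup S)%:M.
  by rewrite linearB/= sA tr_scalar_mx.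
have B0 w : 0 <= bform (A - (sup S)%:M) w w.
  have [->|w0] := eqVneq w 0; first by rewrite /bform !mulmx0 mxE.
  rewrite bB subr_ge0 -ler_pdivlMr; last by rewrite lt0r bform1_eq0 w0 bform1_ge0.
  by apply: ge_sup; [exists (- K)|exact: Sub].
have [uB|nuB] := boolP (A - (sup S)%:M \in unitmx).
  have [c c0 hc] := psd_unit_coercive sB B0 uB.
  have : S (sup S + c).
    by move=> w; have := hc w; rewrite bB mulrDl; lra.
  move=> /(sup_upper_bound supS); lra.
have muR : root (char_poly A) (sup S).
  rewrite -eigenvalue_root_char; apply/eigenvalueP.
  move: nuB; rewrite -row_free_unit -kermx_eq0 => /rowV0Pn[w /sub_kermxP wB w0].
  exists w => //; apply/eqP; rewrite -subr_eq0 -mul_mx_scalar -mulmxBr.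
  by rewrite wB.
apply: le_trans (_ : sup S * bform 1%:M v v <= _).
  by rewrite ler_wpM2r ?bform1_ge0// hrho.
by rewrite -subr_ge0 -bB.
Qed.

(** Positivity rules out the default value: [spectrum] is empty when the characteristic polynomial
    does not split, and then [lambda_min] is 0. *)
Lemma lambda_min_rayleigh A : A^T = A -> 0 < lambda_min A ->
  forall v, lambda_min A * bform 1%:M v v <= bform A v v.
Proof.
move=> sA l0; apply: rayleigh_ge => // mu.
move: l0; rewrite /lambda_min /spectrum.
case: xgetP => [s _ [ss ->] s0|_]; last by rewrite ltxx.
rewrite root_prod_XsubC => smu.
case: s ss s0 smu => [|x s]//= /(order_path_min le_trans) /allP xs _.
by rewrite inE => /orP[/eqP->//|/xs].
Qed.

(** Positivity again excludes the default 0, so the list has a second entry; as it is sorted, only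
    its first entry can vanish, and 0 is at most a simple root. *)
Lemma lambda2_gt0_simple A : 0 < lambda2 A -> ~~ ('X^2 %| char_poly A).
Proof.
rewrite /lambda2 /spectrum; case: xgetP => [s _ [ss ->]|_]; last by rewrite ltxx.
case: s ss => [|x [|y s]]//=; rewrite ?ltxx// => /andP[xy ys] y0.
rewrite big_cons; set q := \prod_(_ <- _) _.
have q0 : ~~ root q 0.
  rewrite root_prod_XsubC inE negb_or lt_eqF//=; apply/negP => s0.
  have := order_path_min le_trans ys => /allP /(_ _ s0).
  by rewrite leNgt y0.
rewrite Gauss_dvdpl; last first.
  rewrite coprimep_expl// -[X in coprimep X]subr0 -polyC0.
  by rewrite coprimep_sym coprimep_XsubC.
apply/negP => /dvdp_leq; rewrite polyXsubC_eq0 size_polyXn size_XsubC.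
by move=> /(_ isT).
Qed.

(** The Gram matrix of the two rows is diagonal with nonzero entries, hence invertible. *)
Lemma rank_orthogonal_pair u v : u != 0 -> v != 0 -> bform 1%:M u v = 0 ->
  \rank (col_mx u^T v^T) = 2.
Proof.
move=> u0 v0 uv; apply/eqP; rewrite eqn_leq rank_leq_row/=.
pose W := col_mx u^T v^T.
have WW : W *m W^T \in unitmx.
  rewrite /W tr_col_mx !trmxK mul_col_row.
  have e0 (x y : 'cV[R]_n) : x^T *m y = (bform 1%:M x y)%:M.
    by rewrite /bform mulmx1 [LHS]mx11_scalar.
  rewrite !e0 (bformC v u (trmx1 _ _)) uv raddf0 unitmxE det_ublock !det_scalar1.
  by rewrite unitfE mulf_neq0// bform1_eq0.
by apply: leq_trans (mxrankM_maxl W W^T); rewrite mxrank_unit.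
Qed.

(** The form of the all-ones matrix [J] vanishes on zero-sum vectors, so coercivity of [A + J] is
    enough. A nonzero null vector [w] of [A + J] would have zero sum and be null for [A]; being
    orthogonal to the constant null vector, it would make 0 a double root. *)
Lemma lambda2_poincare A : A^T = A -> (forall w, 0 <= bform A w w) ->
  A *m const_mx 1 = (0 : 'cV_n) -> 0 < lambda2 A ->
  exists2 c : R, 0 < c & forall v, \sum_i v i 0 = 0 ->
    c * bform 1%:M v v <= bform A v v.
Proof.
move=> sA A0 A1 /lambda2_gt0_simple l2; pose o : 'cV[R]_n := const_mx 1.
pose J : 'M[R]_n := const_mx 1.
have JE : J = o *m o^T.
  by apply/matrixP => i j; rewrite !mxE big_ord1 !mxE mulr1.
have oE v : bform 1%:M o v = \sum_i v i 0.
  by rewrite bform1; apply: eq_bigr => i _; rewrite mxE mul1r.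
have bJ v : bform J v v = (\sum_i v i 0) ^+ 2.
  rewrite /bform JE mulmxA -mulmxA !mxE big_ord1 expr2; congr (_ * _).
    by rewrite !mxE; apply: eq_bigr => i _; rewrite !mxE mulr1.
  by rewrite !mxE; apply: eq_bigr => i _; rewrite !mxE mul1r.
have sB : (A + J)^T = A + J by rewrite linearD/= sA /J trmx_const.
have B0 w : 0 <= bform (A + J) w w.
  by rewrite bformDm bJ addr_ge0// sqr_ge0.
have [uB|] := boolP (A + J \in unitmx).
  have [c c0 hc] := psd_unit_coercive sB B0 uB.
  exists c => // v v0; have := hc v.
  by rewrite bformDm bJ v0 expr0n addr0.
rewrite -row_free_unit -kermx_eq0 => /rowV0Pn[w' /sub_kermxP wB w0'].
exfalso; pose w := w'^T; have w0 : w != 0.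
  by apply: contraNneq w0' => ww; rewrite -[w']trmxK -/w ww trmx0.
have Bw : (A + J) *m w = 0.
  by apply: trmx_inj; rewrite trmx_mul sB trmxK wB trmx0.
have : bform (A + J) w w = 0 by rewrite /bform -mulmxA Bw mulmx0 mxE.
rewrite bformDm bJ => /eqP; rewrite paddr_eq0// ?sqr_ge0// sqrf_eq0.
move=> /andP[_ /eqP w1].
have Aw : A *m w = 0.
  have Jw : J *m w = 0.
    apply/matrixP => i j; rewrite !mxE ord1 -[RHS]w1; apply: eq_bigr => k _.
    by rewrite mxE mul1r.
  by move: Bw; rewrite mulmxDl Jw addr0.
have o0 : o != 0.
  case/cV0Pn: (w0) => i _; apply/eqP => /matrixP/(_ i 0)/eqP.
  by rewrite !mxE oner_eq0.
have := rank_orthogonal_pair o0 w0; rewrite oE => /(_ w1) rk.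
have sub : (col_mx o^T w^T <= kermx A)%MS.
  apply/sub_kermxP; rewrite mul_col_mx -[A]sA -!trmx_mul A1 Aw !trmx0.
  by rewrite col_mx0.
have := mxrankS sub; rewrite rk mxrank_ker => n2.
move/negP: l2; apply; apply: dvdp_trans (dvdp_Xn_char_poly A).
exact: dvdp_exp2l.
Qed.

End quadratic_forms.

(** * Consensus over a window *)

Section consensus_step.
Context {R : rcfType} {V : finType}.
Implicit Types (g : rel V) (y : V -> R).

Definition graph_lap g y i : R := \sum_(l | g i l) (y i - y l).
(** The sum runs over ordered pairs, so a symmetric graph counts each edge twice; hence the halves
    below. *)
Definition dirichlet g y : R := \sum_i \sum_(l | g i l) (y i - y l) ^+ 2.
Definition consensus (b : R) g y i : R := y i - b * graph_lap g y i.

Lemma dirichlet_ge0 g y : 0 <= dirichlet g y.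
Proof. by apply: sumr_ge0 => i _; apply: sumr_ge0 => l _; exact: sqr_ge0. Qed.

Lemma graph_lap_dot g y : symmetric g ->
  \sum_i y i * graph_lap g y i = dirichlet g y / 2.
Proof.
move=> sg; have -> : \sum_i y i * graph_lap g y i =
    \sum_i \sum_l (if g i l then y i * (y i - y l) else 0).
  by apply: eq_bigr => i _; rewrite /graph_lap mulr_sumr big_mkcond.
have E : \sum_i \sum_l (if g i l then y i * (y i - y l) else 0) =
    \sum_i \sum_l (if g i l then - y l * (y i - y l) else 0).
  rewrite exchange_big; apply: eq_bigr => i _; apply: eq_bigr => l _.
  by rewrite sg; case: ifP => // _; ring.
apply: (@mulIf _ 2); rewrite ?pnatr_eq0// divfK ?pnatr_eq0//.
rewrite mulr_natr mulr2n [in X in _ + X]E -big_split/=.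
apply: eq_bigr => i _; rewrite -big_split/= [RHS]big_mkcond/=.
by apply: eq_bigr => l _; case: ifP => _; ring.
Qed.

Lemma graph_lap_sqr g y :
  \sum_i graph_lap g y i ^+ 2 <= #|V|%:R * dirichlet g y.
Proof.
rewrite mulr_sumr; apply: ler_sum => i _; rewrite /graph_lap.
rewrite big_mkcond/= [X in _ * X]big_mkcond/=.
apply: le_trans (sqr_sum_le _) _; rewrite ler_wpM2l//.
by apply: ler_sum => l _; case: ifP => // _; rewrite expr0n.
Qed.

Lemma graph_lap_bound g y i : `|graph_lap g y i| <= 2 * #|V|%:R * l2 y.
Proof.
apply: (le_trans (ler_norm_sum _ _ _)); rewrite big_mkcond/=.
apply: le_trans (_ : \sum_(l : V) (2 * l2 y) <= _); last first.
  by rewrite sumr_const -[X in X <= _]mulr_natl mulrCA mulrA.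
apply: ler_sum => l _; case: ifP => _; last by rewrite mulr_ge0// l2_ge0.
apply: (le_trans (ler_normB _ _)).
by have := normr_le_l2 y i; have := normr_le_l2 y l; lra.
Qed.

(** Expanding the square, the linear term yields [- b * dirichlet g y] and the quadratic one at most
    [b ^+ 2 * #|V| * dirichlet g y]; the smallness of [b * #|V|] makes the latter cost only half of
    the former. *)
Lemma consensus_energy (b : R) g y : symmetric g -> 0 <= b ->
  b * #|V|%:R <= 1 / 2 ->
  \sum_i consensus b g y i ^+ 2 <= \sum_i y i ^+ 2 - b / 2 * dirichlet g y.
Proof.
move=> sg b0 bk; have -> : \sum_i consensus b g y i ^+ 2 = \sum_i y i ^+ 2
    - 2 * b * (\sum_i y i * graph_lap g y i)
    + b ^+ 2 * \sum_i graph_lap g y i ^+ 2.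
  rewrite !mulr_sumr -sumrN -!big_split/=; apply: eq_bigr => i _.
  by rewrite /consensus; ring.
rewrite graph_lap_dot//; have := graph_lap_sqr g y; have := dirichlet_ge0 g y.
move: (dirichlet g y) (\sum_i graph_lap g y i ^+ 2) => D L D0 LD.
have : b ^+ 2 * L <= b ^+ 2 * (#|V|%:R * D) by rewrite ler_wpM2l ?sqr_ge0.
have : b * (b * #|V|%:R) * D <= b * (1 / 2) * D by rewrite ler_wpM2r ?ler_wpM2l.
move: (#|V|%:R) => k; lra.
Qed.

Lemma consensus_l2 (b : R) g y : symmetric g -> 0 <= b ->
  b * #|V|%:R <= 1 / 2 -> l2 (consensus b g y) <= l2 y.
Proof.
move=> sg b0 bk; rewrite ler_sqrt ?sum_sqr_ge0//.
apply: (le_trans (consensus_energy y sg b0 bk)).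
by rewrite lerBlDr lerDl mulr_ge0 ?dirichlet_ge0// divr_ge0.
Qed.

Lemma consensusB (b : R) g x y i :
  consensus b g x i - consensus b g y i = consensus b g (fun j => x j - y j) i.
Proof.
rewrite /consensus /graph_lap.
have -> : \sum_(l | g i l) (x i - y i - (x l - y l)) =
    \sum_(l | g i l) (x i - x l) - \sum_(l | g i l) (y i - y l).
  by rewrite -sumrB; apply: eq_bigr => l _; ring.
ring.
Qed.

End consensus_step.

Section consensus_window.
Context {R : rcfType} {V : finType}.
Variables (b : nat -> R) (g : nat -> rel V).
Hypothesis g_sym : forall t, symmetric (g t).
Hypothesis b_ge0 : forall t, 0 <= b t.
Hypothesis b_decr : forall s t, (s <= t)%N -> b t <= b s.
(** The successor keeps [k] positive when [V] is empty. *)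
Local Notation k := (#|V|.+1%:R : R).

Fixpoint consensus_flow s (y : V -> R) r : V -> R :=
  if r is r'.+1 then
    consensus (b (s + r')%N) (g (s + r')%N) (consensus_flow s y r')
  else y.

Section start.
Variables (s : nat) (y : V -> R).
Hypothesis bs : b s * k <= 1 / 2.
Local Notation f := (consensus_flow s y).

Let bk t : (s <= t)%N -> b t * #|V|%:R <= 1 / 2.
Proof.
move=> st; apply: le_trans bs; apply: ler_pM => //; first exact: b_decr.
by rewrite ler_nat.
Qed.

Lemma consensus_flow_l2 r : l2 (f r) <= l2 y.
Proof.
elim: r => //= r; apply: le_trans; apply: consensus_l2 => //.
by apply: bk; exact: leq_addr.
Qed.

Lemma consensus_flow_energy r : \sum_i f r i ^+ 2 <=
  \sum_i y i ^+ 2 -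
  \sum_(q < r) b (s + q)%N / 2 * dirichlet (g (s + q)%N) (f q).
Proof.
elim: r => [|r IH]; first by rewrite big_ord0 subr0.
rewrite big_ord_recr/= opprD addrA.
apply: le_trans (consensus_energy _ _ _ _) _ => //; last by rewrite lerD2r.
by apply: bk; exact: leq_addr.
Qed.

Lemma consensus_flow_drift r i :
  `|f r i - y i| <= r%:R * (b s * (2 * k * l2 y)).
Proof.
have y0 := l2_ge0 y.
elim: r => [|r IH] /=; first by rewrite subrr normr0 mul0r.
have -> : consensus (b (s + r)%N) (g (s + r)%N) (f r) i - y i =
    (f r i - y i) - b (s + r)%N * graph_lap (g (s + r)%N) (f r) i.
  by rewrite /consensus; ring.
apply: (le_trans (ler_normB _ _)); rewrite -natr1 mulrDl mul1r.
apply: lerD => //; rewrite normrM (ger0_norm (b_ge0 _)).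
apply: ler_pM => //; first by apply: b_decr; exact: leq_addr.
apply: (le_trans (graph_lap_bound _ _ _)).
apply: ler_pM; rewrite ?mulr_ge0 ?l2_ge0//.
  by rewrite ler_wpM2l// ler_nat.
exact: consensus_flow_l2.
Qed.

(* If little energy is dissipated over a window, every edge seen during the
   window has small tension when it is seen; as the state hardly moves, all
   tensions are small at the start, against the Poincare inequality. *)
Lemma consensus_flow_contraction (T : nat) (E : rel V) (c : R) :
  c * \sum_i y i ^+ 2 <= \sum_i \sum_(j | E i j) (y i - y j) ^+ 2 ->
  (forall i j, E i j -> exists2 q, (q < T)%N & g (s + q)%N i j) ->
  8 * k ^+ 2 * (2 * k * (T%:R * b s)) ^+ 2 <= c / 2 ->
  b (s + T)%N * (c / (8 * k ^+ 2)) <= 1 ->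
  l2 (f T) <= (1 - b (s + T)%N * (c / (16 * k ^+ 2))) * l2 y.
Proof.
move=> poinc cover small le1.
have k0 : 0 < k by rewrite ltr0n.
set Y := \sum_i y i ^+ 2 in poinc *.
have Y0 : 0 <= Y by exact: sum_sqr_ge0.
set D := \sum_(q < T) dirichlet (g (s + q)%N) (f q).
have edge i j : E i j ->
    (y i - y j) ^+ 2 <= 2 * D + 8 * (2 * k * (T%:R * b s)) ^+ 2 * Y.
  move=> /cover[q qT gij].
  have QD : (f q i - f q j) ^+ 2 <= D.
    rewrite /D (bigD1 (Ordinal qT))//= /dirichlet (bigD1 i)//= (bigD1 j)//=.
    rewrite -!addrA lerDl !addr_ge0//; apply: sumr_ge0 => l _.
    - exact: sqr_ge0.
    - by apply: sumr_ge0 => ? _; exact: sqr_ge0.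
    - exact: dirichlet_ge0.
  have dr l : `|f q l - y l| <= T%:R * (b s * (2 * k * l2 y)).
    apply: (le_trans (consensus_flow_drift q l)); rewrite ler_wpM2r//.
      by rewrite !mulr_ge0// l2_ge0.
    by rewrite ler_nat ltnW.
  have := dr i; have := dr j.
  have := sqr_l2 y; rewrite -/Y => <-.
  set w := T%:R * _.
  have -> : 8 * (2 * k * (T%:R * b s)) ^+ 2 * l2 y ^+ 2 = 8 * w ^+ 2.
    by rewrite /w; ring.
  move: QD; move: (f q i) (f q j) (y i) (y j) => a a' x x' QD.
  rewrite !ler_norml => /andP[h1 h2] /andP[h3 h4].
  have w0 : 0 <= w by lra.
  have dd : ((x - x') - (a - a')) ^+ 2 <= (2 * w) ^+ 2.
    have w20 : 0 <= 2 * w by lra.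
    rewrite -[X in X <= _](real_normK (num_real _)) ler_pXn2r ?nnegrE//.
    by rewrite ler_norml; apply/andP; split; lra.
  (* This square equals 2 p^2 + 2 (q - p)^2 - q^2 for p = a - a' and q = x - x', so the initial
     tension q^2 is at most 2 D + 8 w^2. *)
  have := sqr_ge0 ((x - x') - 2 * (a - a')); lra.
have sumE : \sum_i \sum_(j | E i j) (y i - y j) ^+ 2 <=
    k ^+ 2 * (2 * D + 8 * (2 * k * (T%:R * b s)) ^+ 2 * Y).
  set B := 2 * D + _ in edge *.
  have B0 : 0 <= B.
    rewrite addr_ge0 ?mulr_ge0 ?sqr_ge0//.
    by apply: sumr_ge0 => q _; exact: dirichlet_ge0.
  apply: le_trans (_ : \sum_(i : V) \sum_(j : V) B <= _).
    apply: ler_sum => i _; rewrite big_mkcond; apply: ler_sum => j _.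
    by case: ifP => // /edge.
  rewrite !sumr_const -!mulrnA -[X in X <= _]mulr_natl ler_wpM2r//.
  by rewrite natrM expr2 ler_pM// ler_nat.
(* By [small], the drift accounts for at most half of the Poincare lower bound; the other half must
   come from the dissipation [D]. *)
have Dge : c / (4 * k ^+ 2) * Y <= D.
  rewrite mulrAC ler_pdivrMr; last by rewrite mulr_gt0// exprn_gt0.
  have : 8 * k ^+ 2 * (2 * k * (T%:R * b s)) ^+ 2 * Y <= c / 2 * Y.
    by rewrite ler_wpM2r.
  move: poinc sumE; set S := \sum_i \sum_(j | _) _.
  set W := (2 * k * _) ^+ 2; lra.
have bT0 := b_ge0 (s + T).
have sqf : \sum_i f T i ^+ 2 <= (1 - b (s + T)%N * (c / (8 * k ^+ 2))) * Y.
  apply: (le_trans (consensus_flow_energy T)); rewrite mulrBl mul1r lerD2l lerN2.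
  apply: le_trans (_ : b (s + T)%N / 2 * D <= _).
    have -> : b (s + T)%N * (c / (8 * k ^+ 2)) * Y =
        b (s + T)%N / 2 * (c / (4 * k ^+ 2) * Y).
      have e (x z K : R) : K != 0 ->
          x * (z / (8 * K ^+ 2)) * Y = x / 2 * (z / (4 * K ^+ 2) * Y).
        by move=> K0; field.
      by apply: e; rewrite gt_eqF.
    by rewrite ler_wpM2l ?divr_ge0.
  rewrite /D mulr_sumr; apply: ler_sum => q _.
  rewrite ler_wpM2r ?dirichlet_ge0// ler_pM2r ?invr_gt0//.
  by apply: b_decr; rewrite leq_add2l ltnW.
(* Passing from squared norms to norms uses 1 - x <= (1 - x / 2)^2, which halves the rate: 16 in
   place of 8. *)
have e16 : c / (16 * k ^+ 2) = c / (8 * k ^+ 2) / 2.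
  have e (z K : R) : K != 0 -> z / (16 * K ^+ 2) = z / (8 * K ^+ 2) / 2.
    by move=> K0; field.
  by apply: e; rewrite gt_eqF.
rewrite e16 mulrA; set x := b (s + T)%N * _ in sqf le1 *.
have x2 : 0 <= 1 - x / 2 by lra.
rewrite -(@ler_pXn2r _ 2) ?nnegrE ?mulr_ge0 ?l2_ge0//.
rewrite exprMn !sqr_l2; apply: (le_trans sqf); rewrite -/Y ler_wpM2r//.
by have := sqr_ge0 x; lra.
Qed.

End start.

(** The perturbed and the free path share their state at time [s]; a consensus step is linear and
    does not increase the norm of their difference, so the perturbations just add up. *)
Lemma consensus_perturbed (z u : nat -> V -> R) (U : nat -> R) s r :
  b s * k <= 1 / 2 ->
  (forall t i, z t.+1 i = consensus (b t) (g t) (z t) i + u t i) ->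
  (forall t, l2 (u t) <= U t) ->
  (forall t, (s <= t)%N -> U t <= U s) ->
  l2 (z (s + r)%N) <= l2 (consensus_flow s (z s) r) + r%:R * U s.
Proof.
move=> bs zE uU Udecr; set f := consensus_flow s (z s).
have : l2 (fun i => z (s + r)%N i - f r i) <= r%:R * U s.
  elim: r => [|r IH].
    rewrite mul0r /l2 big1 ?sqrtr0// => i _.
    by rewrite addn0 /f/= subrr expr0n.
  rewrite -natr1 mulrDl mul1r.
  have -> : l2 (fun i => z (s + r.+1)%N i - f r.+1 i) =
      l2 (fun i => consensus (b (s + r)%N) (g (s + r)%N)
            (fun j => z (s + r)%N j - f r j) i + u (s + r)%N i).
    apply: eq_l2 => i; rewrite addnS zE /f/= -/f -consensusB; ring.
  apply: (le_trans (l2_triangle _ _)); apply: lerD; last first.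
    by apply: (le_trans (uU _)); apply: Udecr; exact: leq_addr.
  apply: le_trans IH; apply: consensus_l2 => //.
  apply: le_trans bs; apply: ler_pM => //; last by rewrite ler_nat.
  by apply: b_decr; exact: leq_addr.
move=> h; apply: le_trans (lerD (lexx _) h).
have -> : l2 (z (s + r)%N) = l2 (fun i => f r i + (z (s + r)%N i - f r i)).
  by apply: eq_l2 => i; ring.
exact: l2_triangle.
Qed.

End consensus_window.

(** * Power weights and decay of the disagreement *)

Section inverse_powers.
Context {R : realType}.
Implicit Types (p q e : R) (s t : nat).

(* [decaying c tau t] is convertible to [c * ipow tau t]. *)
Definition ipow p t : R := t.+1%:R `^ (- p).

Lemma ipow_gt0 p t : 0 < ipow p t.
Proof. by rewrite powR_gt0. Qed.

Lemma ipow_ge0 p t : 0 <= ipow p t.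
Proof. exact/ltW/ipow_gt0. Qed.

Lemma ipowD p q t : ipow (p + q) t = ipow p t * ipow q t.
Proof. by rewrite /ipow opprD powRD// pnatr_eq0 implybT. Qed.

Lemma ipow1 t : ipow 1 t = t.+1%:R^-1.
Proof. by rewrite /ipow powR_inv1. Qed.

Lemma ler_ipow_exp p q t : p <= q -> ipow q t <= ipow p t.
Proof. by move=> pq; rewrite /ipow ler_powR ?lerN2// ler1n. Qed.

Lemma ipow_decr p s t : 0 <= p -> (s <= t)%N -> ipow p t <= ipow p s.
Proof.
move=> p0 st; rewrite /ipow !powRN lef_pV2 ?posrE ?powR_gt0//.
by rewrite ge0_ler_powR ?nnegrE// ler_nat.
Qed.

Lemma ipow_le_ratio p s t : 0 <= p -> p <= 1 -> (s <= t)%N ->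
  ipow p s <= ipow p t * (t.+1%:R / s.+1%:R).
Proof.
move=> p0 p1 st.
have -> : (t.+1%:R / s.+1%:R : R) = ipow 1 s / ipow 1 t.
  by rewrite !ipow1 invrK mulrC.
rewrite mulrA ler_pdivlMr ?ipow_gt0//.
have -> : ipow 1 s = ipow p s * ipow (1 - p) s by rewrite -ipowD subrKC.
have -> : ipow 1 t = ipow p t * ipow (1 - p) t by rewrite -ipowD subrKC.
rewrite mulrCA ler_wpM2l ?ipow_ge0// ler_wpM2l ?ipow_ge0//.
by rewrite ipow_decr// subr_ge0.
Qed.

Lemma ipow_le_double p s t : 0 <= p -> p <= 1 -> (s <= t)%N ->
  (t.+1 <= s.+1.*2)%N -> ipow p s <= 2 * ipow p t.
Proof.
move=> p0 p1 st ts; apply: (le_trans (ipow_le_ratio p0 p1 st)).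
rewrite mulrC ler_wpM2r ?ipow_ge0// ler_pdivrMr// -natrM ler_nat.
by rewrite mul2n.
Qed.

(** The relative decrease of a power weight in one step is at most 1 / (t + 1), which is negligible
    against [ipow tau1 t] when tau1 < 1. *)
Lemma ipow_diff p t : 0 <= p -> p <= 1 ->
  ipow p t - ipow p t.+1 <= ipow p t * ipow 1 t.
Proof.
move=> p0 p1; have := ipow_le_ratio p0 p1 (leqnSn t).
rewrite ipow1 -[in X in X / _]natr1 mulrDl divff ?pnatr_eq0// mulrDr mulr1 mul1r.
move=> h; rewrite lerBlDl; apply: (le_trans h); rewrite lerD2l.
by rewrite ler_wpM2r ?invr_ge0// ipow_decr.
Qed.

Lemma near_ipow_le p e : 0 < p -> 0 < e -> \forall t \near \oo, ipow p t <= e.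
Proof.
move=> p0 e0.
near=> t.
rewrite /ipow powRN invf_ple ?posrE ?powR_gt0//.
have -> : e^-1 = (e^-1 `^ p^-1) `^ p.
  by rewrite -powRrM mulVf ?gt_eqF// powRr1// invr_ge0 ltW.
rewrite ge0_ler_powR ?nnegrE ?powR_ge0// ?ltW//.
apply: le_lt_trans (_ : t%:R < _); last by rewrite ltr_nat.
near: t; exact: nbhs_infty_ger.
Unshelve. all: by end_near. Qed.

Lemma ipow_cvg0 p : 0 < p -> ipow p @ \oo --> (0 : R).
Proof.
move=> p0; apply/cvgr0Pnorm_le => e e0.
by apply: filterS (near_ipow_le p0 e0) => t; rewrite ger0_norm// ipow_ge0.
Qed.

Lemma ipow_sum_unbounded p s B : p <= 1 ->
  ~ (forall n, \sum_(s <= t < s + n) ipow p t <= B).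
Proof.
move=> p1 h; apply: (@dvg_harmonic R).
apply: nondecreasing_is_cvgn.
  apply/nondecreasing_seqP => n.
  by rewrite /series/= big_nat_recr//= lerDl harmonic_ge0.
exists (\sum_(0 <= t < s) harmonic t + B) => _ [n _ <-].
apply: le_trans (_ : \sum_(0 <= t < s + n) harmonic t <= _).
  rewrite /series/= [leRHS](@big_cat_nat _ _ _ n)//= ?leq_addl//.
  by rewrite lerDl sumr_ge0// => i _; rewrite harmonic_ge0.
rewrite (@big_cat_nat _ _ _ s)//= ?leq_addr// lerD2l; apply: le_trans (h n).
apply: ler_sum => t _; apply: le_trans (ler_ipow_exp t p1).
by rewrite ipow1.
Qed.

End inverse_powers.

Section logarithmic_window.
Context {R : realType}.

Lemma bernoulli_ineq (h : R) n : 0 <= h -> 1 + n%:R * h <= (1 + h) ^+ n.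
Proof.
move=> h0; elim: n => [|n IH]; first by rewrite mul0r addr0 expr0.
rewrite exprS; apply: le_trans (_ : (1 + h) * (1 + n%:R * h) <= _); last first.
  by rewrite ler_wpM2l// addr_ge0.
rewrite -natr1; have : 0 <= n%:R * h * h by rewrite !mulr_ge0.
lra.
Qed.

(** With [h = 2^e - 1], Bernoulli's inequality bounds 1 + l h by (2^l)^e, and 2^l <= t + 1 for the
    truncated logarithm [l]. *)
Lemma trunc_log_le_ipow (e : R) : 0 < e ->
  exists2 C : R, 0 < C & forall t, (trunc_log 2 t).+1%:R <= C * ipow (- e) t.
Proof.
move=> e0; pose h : R := 2 `^ e - 1.
have h0 : 0 < h.
  have := gt0_ltr_powR e0 (ler01 : 1 \in Num.nneg) (ler0n R 2 : 2 \in Num.nneg).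
  by rewrite powR1 subr_gt0; apply; rewrite ltr1n.
exists (1 + h^-1) => [|t]; first by rewrite addr_gt0// invr_gt0.
rewrite /ipow opprK.
apply: le_trans (_ : (1 + h^-1) * (2 ^ trunc_log 2 t)%:R `^ e <= _); last first.
  apply: ler_wpM2l; first by rewrite addr_ge0// invr_ge0 ltW.
  apply: ge0_ler_powR; rewrite ?nnegrE ?(ltW e0)// ler_nat.
  case: t => [|t]; first by rewrite trunc_log0 expn0.
  by apply: leq_trans (leqnSn _); exact: trunc_logP.
set l := trunc_log 2 t.
rewrite natrX -powR_mulrn// powRAC powR_mulrn ?powR_ge0//.
have -> : 2 `^ e = 1 + h :> R by rewrite /h subrKC.
have := bernoulli_ineq l (ltW h0) => b.
apply: le_trans (_ : (1 + h^-1) * (1 + l%:R * h) <= _); last first.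
  by apply: ler_wpM2l; rewrite ?addr_ge0 ?invr_ge0 ?(ltW h0).
rewrite mulrDl mul1r [h^-1 * _]mulrDr mulr1 [l%:R * h]mulrC mulKf ?gt_eqF//.
rewrite -natr1 -addrA addrC.
have hi : 0 < h^-1 by rewrite invr_gt0.
have : 0 <= h * l%:R by rewrite mulr_ge0// ltW.
lra.
Qed.

End logarithmic_window.

(** Let x be the contraction rate over the window that ends at t, of order beta_t. The bound K (t +
    1)^-rho is propagated from the start of the window to its end: half of x pays for the decrease
    of this bound over the window, the other half for the perturbation. *)
Lemma consensus_decay (R : realType) (V : finType) (cb tau1 tau2 taug C : R)
    (g : nat -> rel V) (z u : nat -> V -> R) (T : nat -> nat) (E : rel V)
    (c : R) :
  0 < cb -> 0 < tau2 -> tau2 < tau1 -> 0 < taug -> taug < 1 - tau1 -> 0 <= C ->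
  (forall t, symmetric (g t)) ->
  (forall t i,
     z t.+1 i = consensus (cb * ipow tau2 t) (g t) (z t) i + u t i) ->
  (forall t, l2 (u t) <= C * ipow (tau1 + taug) t) ->
  0 < c ->
  (forall t,
     c * \sum_i z t i ^+ 2 <= \sum_i \sum_(j | E i j) (z t i - z t j) ^+ 2) ->
  (forall t, (0 < T t)%N) ->
  (forall e : R, 0 < e ->
     exists2 D : R, 0 < D & forall t, (T t)%:R <= D * ipow (- e) t) ->
  (\forall t \near \oo, forall i j, E i j ->
     exists2 q, (q < T t)%N & g (t - T t + q)%N i j) ->
  exists rho K : R, taug < rho /\ forall t, l2 (z t) <= K * ipow rho t.
Proof.
move=> cb_gt0 tau2_gt0 tau21 taug_gt0 taug_lt C_ge0 g_sym zE u_le c_gt0.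
move=> poincare T_gt0 T_small cover.
(* The window length costs a factor (t + 1)^e. Both factors of the product are below 1, so [e] is
   below each of them, and hence below 1 - tau2. *)
pose e := tau2 * (tau1 - tau2) / 2.
have [e0 e1 e2] : [/\ 0 < e, e < tau1 - tau2 & e < tau2].
  have : 0 < tau2 * (tau1 - tau2) by rewrite mulr_gt0// subr_gt0.
  have : tau2 * (tau1 - tau2) < 1 * (tau1 - tau2).
    by rewrite ltr_pM2r ?subr_gt0//; lra.
  have : tau2 * (tau1 - tau2) < tau2 * 1 by rewrite ltr_pM2l//; lra.
  by rewrite /e; split; lra.
have e3 : e < 1 - tau2 by lra.
have e4 : e < 1 by lra.
have [D D0 TD] := T_small e e0.
(* [rho] solves rho + tau2 = tau1 + taug - e, which gives contraction and accumulated perturbation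
   the same order. It exceeds [taug] because e < tau1 - tau2. *)
pose rho := taug + (tau1 - tau2 - e).
have rho0 : 0 <= rho by rewrite /rho; lra.
have rho1 : rho <= 1 by rewrite /rho; lra.
have t1g0 : 0 <= tau1 + taug by lra.
have t1g1 : tau1 + taug <= 1 by lra.
have t20 : 0 <= tau2 by lra.
have t21 : tau2 <= 1 by lra.
pose k := #|V|.+1%:R : R.
have k0 : 0 < k by rewrite ltr0n.
pose kap := c / (16 * k ^+ 2).
have kap0 : 0 < kap by rewrite divr_gt0// mulr_gt0// exprn_gt0.
pose b t := cb * ipow tau2 t.
have b0 t : 0 < b t by rewrite mulr_gt0// ipow_gt0.
have bdecr s t : (s <= t)%N -> b t <= b s.
  by move=> st; rewrite ler_wpM2l ?ipow_decr// ltW.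
have Tsmall (p d : R) : e < p -> 0 < d ->
    \forall t \near \oo, (T t)%:R * ipow p t <= d.
  move=> ep d0; have pe0 : 0 < p - e by rewrite subr_gt0.
  have := near_ipow_le pe0 (divr_gt0 d0 D0); apply: filterS => t.
  rewrite ler_pdivlMr// => h; apply: le_trans h.
  rewrite addrC ipowD mulrAC ler_wpM2r ?ipow_ge0// mulrC.
  exact: TD.
(* The threshold does not depend on [K], which can therefore be enlarged afterwards to cover the
   finitely many earlier times. *)
have step : \forall t \near \oo, (T t <= t)%N /\ forall K : R, 0 <= K ->
    4 * D * C <= kap * cb * K ->
    l2 (z (t - T t)%N) <= K * ipow rho (t - T t)%N ->
    l2 (z t) <= K * ipow rho t.
  near=> t.
  (* The window covers at most half of the past, so weights with exponents in [0, 1] change by a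
     factor at most 2 across it. *)
  have Th : (T t)%:R * ipow 1 t <= 1 / 2 :> R.
    near: t; apply: Tsmall; last by rewrite divr_gt0.
    exact: e4.
  set s := (t - T t)%N.
  have T2 : ((T t).*2 <= t.+1)%N.
    move: Th; rewrite ipow1 ler_pdivrMr// mulrC mulrA mulr1 ler_pdivlMr//.
    by rewrite -natrM ler_nat muln2.
  have Tt : (T t <= t)%N.
    by rewrite -ltnS; apply: leq_trans T2; rewrite -addnn -addn1 leq_add2l.
  split=> // K K0 KD IH.
  have st : (s <= t)%N by exact: leq_subr.
  have sTt : (s + T t)%N = t by rewrite subnK.
  have ts2 : (t.+1 <= s.+1.*2)%N.
    by clear - T2 sTt; lia.
  have U2 (q : R) : 0 <= q -> q <= 1 -> ipow q s <= 2 * ipow q t.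
    by move=> q0 q1; exact: ipow_le_double.
  have bs2 : b s <= 2 * b t by rewrite mulrCA; apply: ler_wpM2l; [exact: ltW|exact: U2].
  have bsk : b s * k <= 1 / 2.
    have : ipow tau2 t <= 1 / (4 * cb * k).
      near: t; apply: near_ipow_le => //; rewrite divr_gt0// mulr_gt0//.
      by rewrite mulr_gt0.
    rewrite ler_pdivlMr ?mulr_gt0// => h.
    apply: le_trans (_ : 2 * b t * k <= _); first by rewrite ler_wpM2r// ltW.
    by rewrite /b; clear - h; lra.
  have Tbs : (T t)%:R * b s <= Num.sqrt c / (8 * k ^+ 2).
    have : (T t)%:R * ipow tau2 t <= Num.sqrt c / (8 * k ^+ 2) / (2 * cb).
      near: t; apply: Tsmall => //; rewrite !divr_gt0 ?sqrtr_gt0 ?mulr_gt0//.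
    rewrite ler_pdivlMr ?mulr_gt0// => h.
    apply: le_trans h; apply: le_trans (_ : (T t)%:R * (2 * b t) <= _).
      by rewrite ler_wpM2l.
    by rewrite /b le_eqVlt; apply/orP; left; apply/eqP; ring.
  have small : 8 * k ^+ 2 * (2 * k * ((T t)%:R * b s)) ^+ 2 <= c / 2.
    have -> : c / 2 = 8 * k ^+ 2 * (2 * k * (Num.sqrt c / (8 * k ^+ 2))) ^+ 2.
      have -> : 8 * k ^+ 2 * (2 * k * (Num.sqrt c / (8 * k ^+ 2))) ^+ 2 =
          Num.sqrt c ^+ 2 / 2.
        have fe (K' x : R) : K' != 0 ->
            8 * K' ^+ 2 * (2 * K' * (x / (8 * K' ^+ 2))) ^+ 2 = x ^+ 2 / 2.
          by move=> K0'; field.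
        by apply: fe; rewrite gt_eqF.
      by rewrite sqr_sqrtr// ltW.
    have kn : 0 <= k by exact: ltW.
    have bn : 0 <= b s by exact: ltW.
    apply: ler_wpM2l; first by rewrite mulr_ge0// exprn_ge0.
    have k2n : 0 <= 2 * k by rewrite mulr_ge0.
    have Tbn : 0 <= (T t)%:R * b s by rewrite mulr_ge0.
    apply: lerXn2r; rewrite ?nnegrE; last by rewrite ler_wpM2l.
      exact: mulr_ge0.
    by apply: mulr_ge0 => //; apply: le_trans Tbn Tbs.
  have bt1 : b t * (c / (8 * k ^+ 2)) <= 1.
    have : ipow tau2 t <= 1 / (cb * (c / (8 * k ^+ 2))).
      near: t; apply: near_ipow_le => //.
      by rewrite divr_gt0// mulr_gt0// divr_gt0// mulr_gt0// exprn_gt0.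
    rewrite ler_pdivlMr; last by rewrite mulr_gt0// divr_gt0// mulr_gt0// exprn_gt0.
    by rewrite /b mulrCA mulrA.
  have cov : forall i j, E i j -> exists2 q, (q < T t)%N & g (s + q)%N i j.
    by rewrite /s; near: t.
  have contr := @consensus_flow_contraction R V b g g_sym (fun t => ltW (b0 t))
    bdecr s (z s) bsk (T t) E c (poincare s) cov small.
  rewrite sTt in contr; move/(_ bt1): contr => contr.
  have Ud r : (s <= r)%N -> C * ipow (tau1 + taug) r <= C * ipow (tau1 + taug) s.
    by move=> sr; rewrite ler_wpM2l// ipow_decr.
  have := @consensus_perturbed R V b g g_sym (fun t => ltW (b0 t)) bdecr z u
    (fun t => C * ipow (tau1 + taug) t) s (T t) bsk zE u_le Ud.
  rewrite sTt => pert; apply: (le_trans pert).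
  set x := b t * (c / (16 * k ^+ 2)) in contr.
  have x0 : 0 <= x by rewrite mulr_ge0 ?ltW.
  have x1 : 0 <= 1 - x.
    have <- : b t * (c / (8 * k ^+ 2)) / 2 = x.
      have fe (K' x' y : R) : K' != 0 ->
          y * (x' / (8 * K' ^+ 2)) / 2 = y * (x' / (16 * K' ^+ 2)).
        by move=> K0'; field.
      by apply: fe; rewrite gt_eqF.
    rewrite subr_ge0 ler_pdivrMr// mul1r; apply: (le_trans bt1).
    by rewrite ler1n.
  have ratio : (t.+1%:R / s.+1%:R : R) <= 1 + x / 2.
    have h : (T t)%:R * ipow (1 : R) t <= x / 4.
      have -> : ipow 1 t = ipow (1 - tau2) t * ipow tau2 t :> R.
        by rewrite -ipowD subrK.
      have -> : x / 4 = kap * cb / 4 * ipow tau2 t by rewrite /x /b /kap; ring.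
      rewrite mulrA; apply: ler_wpM2r; first exact: ipow_ge0.
      by near: t; apply: Tsmall => //; rewrite divr_gt0// mulr_gt0.
    move: h; rewrite ipow1 ler_pdivrMr// => h.
    rewrite ler_pdivrMr// -[in leLHS]sTt -addSn natrD mulrDl mul1r lerD2l.
    apply: (le_trans h).
    have : t.+1%:R <= 2 * s.+1%:R :> R by rewrite -natrM ler_nat mul2n.
    move=> /(ler_wpM2l x0) h2; clear - h2; lra.
  (* Moving the bound from [s] to [t] costs a factor 1 + x / 2, because T_t / t is negligible
     against beta_t; and (1 - x) (1 + x / 2) <= 1 - x / 2. *)
  have first : l2 (consensus_flow b g s (z s) (T t)) <=
      K * ipow rho t * (1 - x / 2).
    apply: (le_trans contr).
    apply: le_trans (_ : (1 - x) * (K * (ipow rho t * (1 + x / 2))) <= _).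
      rewrite ler_wpM2l//; apply: (le_trans IH); rewrite ler_wpM2l//.
      apply: (le_trans (ipow_le_ratio rho0 rho1 st)).
      by rewrite ler_wpM2l ?ipow_ge0.
    have : 0 <= K * ipow rho t * x ^+ 2.
      by apply: mulr_ge0; [apply: mulr_ge0 => //; exact: ipow_ge0|exact: sqr_ge0].
    by move=> h; clear - h; lra.
  (* Here [4 * D * C <= kap * cb * K] is needed: one factor 2 comes from moving the weight from [s]
     to [t], the other from [x / 2]. *)
  have second : (T t)%:R * (C * ipow (tau1 + taug) s) <=
      K * ipow rho t * (x / 2).
    apply: le_trans (_ : D * ipow (- e) t * (C * (2 * ipow (tau1 + taug) t)) <= _).
      apply: ler_pM => //; first by rewrite mulr_ge0// ipow_ge0.
      by apply: ler_wpM2l => //; exact: U2.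
    have -> : D * ipow (- e) t * (C * (2 * ipow (tau1 + taug) t)) =
        4 * D * C / 2 * (ipow tau2 t * ipow rho t).
      have -> : ipow tau2 t * ipow rho t = ipow (- e) t * ipow (tau1 + taug) t.
        by rewrite -!ipowD /rho; congr ipow; ring.
      by field.
    have -> : K * ipow rho t * (x / 2) =
        kap * cb * K / 2 * (ipow tau2 t * ipow rho t).
      by rewrite /x /b /kap; ring.
    by rewrite ler_wpM2r ?mulr_ge0 ?ipow_ge0// ler_wpM2r.
  by clear - first second; lra.
have [t1 _ stepP] := step.
(* The first summand is what [step] requires; the second enforces the bound at the times before
   [t1]. *)
exists rho; exists (4 * D * C / (kap * cb) +
  \sum_(t < t1) l2 (z t) / ipow rho t).
set K := (X in _ /\ forall t, _ <= X * _).
have K1 : 0 <= 4 * D * C / (kap * cb).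
  apply: divr_ge0; last by rewrite mulr_ge0// ltW.
  by rewrite mulr_ge0// mulr_ge0// ltW.
have K2 : 0 <= \sum_(t < t1) l2 (z t) / ipow rho t.
  by apply: sumr_ge0 => t _; rewrite divr_ge0 ?l2_ge0 ?ipow_ge0.
have KK : 4 * D * C / (kap * cb) <= K by rewrite lerDl.
split; first by rewrite /rho; lra.
elim/ltn_ind => t IH; have [tt1|t1t] := ltnP t t1.
  rewrite -ler_pdivrMr ?ipow_gt0// /K (bigD1 (Ordinal tt1))//=.
  rewrite addrCA lerDl addr_ge0//.
  by apply: sumr_ge0 => i _; rewrite divr_ge0 ?l2_ge0 ?ipow_ge0.
have [Tt] := stepP t t1t; apply; first exact: addr_ge0.
  have kc : 0 < kap * cb by exact: mulr_gt0.
  by rewrite -ler_pdivrMl// mulrC.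
by apply: IH; rewrite ltn_subrL T_gt0/=; apply: leq_trans (T_gt0 t) Tt.
Unshelve. all: by end_near. Qed.

(** * Saturated innovations and the Lyapunov function *)

Section gain.
Context {R : realType}.
Implicit Types g x B : R.

Lemma gain_ge0 g x : 0 <= g -> 0 <= gain g x.
Proof.
move=> g0; rewrite /gain; case: eqP => // _.
by rewrite le_min ler01/= mulr_ge0// invr_ge0.
Qed.

Lemma gain_le1 g x : gain g x <= 1.
Proof. by rewrite /gain; case: eqP => // _; rewrite ge_min lexx. Qed.

(** Clipping to [- g, g] removes the division: the correction is seen to be bounded and to depend
    measurably on the innovation. *)
Lemma gain_mulr g x : 0 <= g -> gain g x * x = Num.max (- g) (Num.min g x).
Proof.
move=> g0; rewrite /gain; have [->|x0] := eqVneq x 0.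
  by rewrite mulr0 (min_idPr g0) (max_idPr _)// oppr_le0.
have xp : 0 < `|x| by rewrite normr_gt0.
have [gx|xg] := ltP (g * `|x|^-1) 1.
  move: gx; rewrite ltr_pdivrMr// mul1r => gx.
  have [xn|xn] := leP 0 x.
    rewrite ger0_norm// in gx xp *; rewrite mulfVK// (min_idPl (ltW gx)).
    by rewrite (max_idPr _)//; lra.
  rewrite ltr0_norm// in gx xp *.
  rewrite invrN mulrN mulNr mulfVK// (min_idPr _); last by lra.
  by rewrite (max_idPl _)//; lra.
move: xg; rewrite ler_pdivlMr// !mul1r ler_norml => /andP[x1 x2].
by rewrite (min_idPr x2) (max_idPr x1).
Qed.

Lemma gain_mulr_le g x : 0 <= g -> `|gain g x * x| <= g.
Proof.
move=> g0; rewrite gain_mulr// ler_norml le_max lexx/= ge_max ge_min lexx/=.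
by rewrite andbT; lra.
Qed.

Lemma gain_ge g x B : 0 < B -> g <= B -> `|x| <= B -> 0 <= g ->
  g / B <= gain g x.
Proof.
move=> B0 gB xB g0; rewrite /gain; have [x0|x0] := eqVneq x 0.
  by rewrite ler_pdivrMr// mul1r.
rewrite le_min ler_pdivrMr// mul1r gB/= ler_wpM2l//.
by rewrite lef_pV2// posrE// normr_gt0.
Qed.

End gain.

(** A decrease at every late time would contradict the divergence of the sum of alpha_t gamma_t, so
    [phi] gets below [K1 * gam t] at some late time. That region is invariant from then on: one step
    from below [D * gam t] cannot leave it, and from above [D * gam t] the decrease of [phi]
    outpaces that of the barrier, since tau1 < 1. *)
Lemma trapped_sequence (R : realType) (ca cg tau1 taug D C1 c0 : R)
    (phi : nat -> R) :
  0 < ca -> 0 < cg -> 0 < tau1 -> 0 < taug -> taug < 1 - tau1 ->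
  0 <= D -> 0 < C1 -> 0 < c0 -> (forall t, 0 <= phi t) ->
  (\forall t \near \oo, phi t.+1 <=
     phi t + C1 * (ca * ipow tau1 t) * (cg * ipow taug t)) ->
  (\forall t \near \oo, D * (cg * ipow taug t) <= phi t ->
     phi t.+1 <= phi t - c0 * (ca * ipow tau1 t) * (cg * ipow taug t)) ->
  exists K, forall t, phi t <= K * ipow taug t.
Proof.
move=> ca0 cg0 t10 tg0 tglt D0 C10 c00 phi0 up down.
have tg1 : taug <= 1 by lra.
have t1g1 : tau1 + taug <= 1 by lra.
pose al t := ca * ipow tau1 t; pose gam t := cg * ipow taug t.
have gam0 t : 0 < gam t by rewrite mulr_gt0// ipow_gt0.
have al0 t : 0 < al t by rewrite mulr_gt0// ipow_gt0.
(* From below [D * gam t], one step gains at most [gam t]; the factor 2 absorbs the passage from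
   [gam t] to [gam t.+1]. *)
pose K1 := 2 * (D + 1).
have K10 : 0 < K1 by rewrite /K1; lra.
have inv : \forall t \near \oo, phi t <= K1 * gam t -> phi t.+1 <= K1 * gam t.+1.
  near=> t => IH.
  have hup : phi t.+1 <= phi t + C1 * al t * gam t by near: t.
  have hdn : D * gam t <= phi t -> phi t.+1 <= phi t - c0 * al t * gam t.
    by near: t.
  have al1 : C1 * al t <= 1.
    rewrite /al mulrA -ler_pdivlMl ?mulr_gt0// mulr1.
    by near: t; apply: near_ipow_le => //; rewrite invr_gt0 mulr_gt0.
  have [lt|ge] := ltP (phi t) (D * gam t).
    have g2 : gam t <= 2 * gam t.+1.
      rewrite /gam mulrCA ler_wpM2l ?(ltW cg0)// ipow_le_double// ?(ltW tg0)//.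
      by rewrite -addnn -[ltnLHS]addn0 ltn_add2l.
    apply: (le_trans hup).
    have : C1 * al t * gam t <= 1 * gam t by rewrite ler_wpM2r// ltW.
    have : (D + 1) * gam t <= (D + 1) * (2 * gam t.+1).
      by rewrite ler_wpM2l// addr_ge0.
    clear - lt; rewrite /K1; lra.
  apply: (le_trans (hdn ge)).
  have dif : gam t - gam t.+1 <= gam t * ipow 1 t.
    rewrite /gam -mulrBr -mulrA ler_wpM2l ?(ltW cg0)// ipow_diff//.
    exact: ltW.
  have small : K1 * ipow 1 t <= c0 * al t.
    have -> : ipow 1 t = ipow (1 - tau1) t * ipow tau1 t :> R.
      by rewrite -ipowD subrK.
    rewrite /al mulrA [leRHS]mulrA ler_wpM2r ?ipow_ge0//.
    rewrite -ler_pdivlMl//; near: t; apply: near_ipow_le; first by lra.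
    by rewrite mulr_gt0 ?invr_gt0// mulr_gt0.
  have : K1 * (gam t - gam t.+1) <= c0 * al t * gam t.
    apply: le_trans (_ : K1 * (gam t * ipow 1 t) <= _).
      by rewrite ler_wpM2l// ltW.
    by rewrite mulrCA mulrC ler_wpM2r// ltW.
  by clear - IH; lra.
have [t2 _ invP] := inv; have [t3 _ dnP] := down.
pose t4 := maxn t2 t3.
have [t5 t45 h5] : exists2 t5, (t4 <= t5)%N & phi t5 <= K1 * gam t5.
  apply: contrapT => /forall2NP nh.
  have ngt t : (t4 <= t)%N -> K1 * gam t < phi t.
    by move=> tt; have [|/negP] := nh t => //; rewrite -ltNge.
  have dec t : (t4 <= t)%N -> phi t.+1 <= phi t - c0 * al t * gam t.
    move=> tt; apply: (dnP t).
      by rewrite /=; apply: leq_trans tt; exact: leq_maxr.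
    apply: le_trans (ltW (ngt _ tt)); rewrite -/(gam t) ler_wpM2r ?(ltW (gam0 _))//.
    by rewrite /K1; lra.
  apply: (@ipow_sum_unbounded R (tau1 + taug) t4 (phi t4 / (c0 * ca * cg)) t1g1).
  move=> n; rewrite ler_pdivlMr; last by rewrite !mulr_gt0.
  have : phi (t4 + n)%N <= phi t4 - (\sum_(t4 <= t < t4 + n) ipow (tau1 + taug) t) * (c0 * ca * cg).
    elim: n => [|n IH]; first by rewrite addn0 big_geq// mul0r subr0.
    rewrite addnS big_nat_recr/= ?leq_addr//.
    apply: (le_trans (dec _ (leq_addr _ _))).
    have -> : c0 * al (t4 + n)%N * gam (t4 + n)%N =
        ipow (tau1 + taug) (t4 + n) * (c0 * ca * cg).
      by rewrite ipowD /al /gam; ring.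
    by clear - IH; lra.
  by have := phi0 (t4 + n)%N; clear; lra.
have stay t : (t5 <= t)%N -> phi t <= K1 * gam t.
  elim: t => [|t IH]; first by rewrite leqn0 => /eqP <-.
  rewrite leq_eqVlt => /predU1P[<-//|]; rewrite ltnS => tt.
  apply: (invP t); last exact: IH.
  by rewrite /=; apply: leq_trans tt; apply: leq_trans t45; exact: leq_maxl.
exists (K1 * cg + \sum_(t < t5) phi t / ipow taug t) => t.
have s0 (Q : pred 'I_t5) : 0 <= \sum_(t < t5 | Q t) phi t / ipow taug t.
  by apply: sumr_ge0 => i _; rewrite divr_ge0// ipow_ge0.
have [tt|tt] := ltnP t t5.
  rewrite -ler_pdivrMr ?ipow_gt0// (bigD1 (Ordinal tt))//= addrCA lerDl.
  by rewrite addr_ge0// mulr_ge0// ltW.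
apply: (le_trans (stay _ tt)); rewrite mulrDl mulrA lerDl.
by rewrite mulr_ge0// ipow_ge0.
Unshelve. all: by end_near. Qed.

(** An uncompromised gain is at least [g] over the largest possible innovation, so saturated
    feedback still gives a decrease linear in [l2 e]. On the compromised streams only the bound [g]
    on the corrections is available, and Cauchy-Schwarz with [Delta] handles them. The errors of the
    uncompromised innovations are measured by [eta]. *)
Lemma innovation_drift (R : realType) (T S : finType) (h : S -> T -> R)
    (A : pred S) (lam Delta g eta : R) (e : T -> R) (u delta : S -> R) :
  0 < g -> 0 <= eta -> 0 <= lam -> g <= l2 e ->
  (forall p, \sum_m h p m ^+ 2 = 1) ->
  (forall p, `|u p| <= g) ->
  (forall p, ~~ A p -> let i := - (\sum_m h p m * e m) + delta p in
     u p = gain g i * i) ->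
  (forall p, ~~ A p -> `|delta p| <= eta * g) ->
  lam * \sum_m e m ^+ 2 <= \sum_(p | ~~ A p) (\sum_m h p m * e m) ^+ 2 ->
  l2 (fun m => \sum_(p | A p) h p m * u p) <= Delta * g ->
  \sum_p (\sum_m h p m * e m) * u p <=
    - (g * l2 e * (lam * (1 - eta) - Delta - #|S|%:R * eta)).
Proof.
move=> g0 eta0 lam0 ge h1 ug uE del lamP DelP.
have e0 : 0 < l2 e by apply: lt_le_trans ge.
have l2h p : l2 (h p) = 1 by rewrite /l2 h1 sqrtr1.
have he p : `|\sum_m h p m * e m| <= l2 e.
  by have := dot_le_l2 (h p) e; rewrite l2h mul1r.
pose x p := \sum_m h p m * e m.
rewrite (bigID A)/=.
have attacked : \sum_(p | A p) x p * u p <= l2 e * (Delta * g).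
  have -> : \sum_(p | A p) x p * u p =
      \sum_m e m * (\sum_(p | A p) h p m * u p).
    under [RHS]eq_bigr do rewrite mulr_sumr.
    rewrite exchange_big; apply: eq_bigr => p _.
    by rewrite /x mulr_suml; apply: eq_bigr => m _; ring.
  apply: le_trans (ler_norm _) _; apply: (le_trans (dot_le_l2 _ _)).
  by rewrite ler_wpM2l// ltW.
(* A bound for every uncompromised innovation: rows have norm 1, and [eta * g <= eta * l2 e]. *)
set B := l2 e * (1 + eta).
have B0 : 0 < B by rewrite mulr_gt0// ltr_pwDl.
have gB : g <= B by rewrite (le_trans ge)// ler_peMr ?(ltW e0)// lerDl.
have good p : ~~ A p ->
    x p * u p <= - (g / B * x p ^+ 2) + l2 e * (eta * g).
  move=> nA; rewrite (uE p nA); set i := - _ + _.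
  have iB : `|i| <= B.
    apply: (le_trans (ler_normD _ _)); rewrite normrN /B mulrDr mulr1 lerD//.
    apply: (le_trans (del p nA)).
    by rewrite mulrC ler_wpM2r.
  have k1 := gain_ge B0 gB iB (ltW g0).
  have k2 := gain_le1 g i; have k3 := gain_ge0 i (ltW g0).
  have -> : x p * (gain g i * i) =
      - (gain g i * x p ^+ 2) + gain g i * (x p * delta p).
    by rewrite /i -/(x p); ring.
  apply: lerD.
    by rewrite lerN2 ler_wpM2r// sqr_ge0.
  apply: le_trans (ler_norm _) _; rewrite normrM (ger0_norm k3) normrM.
  apply: le_trans (_ : 1 * (`|x p| * `|delta p|) <= _).
    by rewrite ler_wpM2r// mulr_ge0.
  by rewrite mul1r ler_pM// ?he ?del.
have goods : \sum_(p | ~~ A p) x p * u p <=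
    - (g / B * (lam * l2 e ^+ 2)) + #|S|%:R * (l2 e * (eta * g)).
  apply: le_trans (ler_sum _ good) _; rewrite big_split/=; apply: lerD.
    rewrite sumrN lerN2 -mulr_sumr sqr_l2; apply: ler_wpM2l => //.
    by rewrite divr_ge0 ?(ltW g0)// ltW.
  rewrite big_mkcond.
  apply: le_trans (_ : \sum_(p : S) l2 e * (eta * g) <= _); last first.
    by rewrite sumr_const mulr_natl.
  apply: ler_sum => p _; case: ifP => // _.
  by rewrite mulr_ge0 ?(ltW e0)// mulr_ge0// ltW.
apply: (le_trans (lerD attacked goods)).
have -> : g / B * (lam * l2 e ^+ 2) = g * l2 e * lam / (1 + eta).
  by rewrite /B; field; rewrite !gt_eqF// ltr_pwDl.
have : g * l2 e * lam * (1 - eta) <= g * l2 e * lam / (1 + eta).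
  apply: ler_wpM2l; first by rewrite mulr_ge0// mulr_ge0 ?(ltW e0)// ltW.
  rewrite -[leRHS]mul1r ler_pdivlMr ?ltr_pwDl//.
  by have := sqr_ge0 eta; clear; lra.
by clear; lra.
Qed.

(** [phi] is the Euclidean norm of the errors rescaled by the square roots of [d], so its square is
    the Lyapunov function. This weight cancels the division by [d m] in the update and leaves
    exactly the sum bounded in [innovation_drift]. *)
Lemma lyapunov_bound (R : realType) (T S : finType) (d : T -> R)
    (h : S -> T -> R) (A : pred S) (ca cg tau1 taug lam Delta dmax : R)
    (e : nat -> T -> R) (u delta : nat -> S -> R) :
  0 < ca -> 0 < cg -> 0 < tau1 -> 0 < taug -> taug < 1 - tau1 ->
  (forall m, 1 <= d m <= dmax) ->
  (forall t m, e t.+1 m =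
     e t m + ca * ipow tau1 t / d m * \sum_p h p m * u t p) ->
  (forall p, \sum_m h p m ^+ 2 = 1) ->
  (forall t p, `|u t p| <= cg * ipow taug t) ->
  (forall t p, ~~ A p -> let i := - (\sum_m h p m * e t m) + delta t p in
     u t p = gain (cg * ipow taug t) i * i) ->
  (forall eta : R, 0 < eta -> \forall t \near \oo, forall p, ~~ A p ->
     `|delta t p| <= eta * (cg * ipow taug t)) ->
  (forall v : T -> R,
     lam * \sum_m v m ^+ 2 <= \sum_(p | ~~ A p) (\sum_m h p m * v m) ^+ 2) ->
  (forall (v : S -> R) (B : R), 0 <= B -> (forall p, `|v p| <= B) ->
     l2 (fun m => \sum_(p | A p) h p m * v p) <= Delta * B) ->
  0 <= Delta -> Delta < lam ->
  exists K, forall t, l2 (e t) <= K * ipow taug t.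
Proof.
move=> ca0 cg0 t10 tg0 tglt dP eE h1 ug uE delS lamP DelP D0 Dlam.
(* For an empty [T], [dmax] is unconstrained; the maximum keeps [D] positive. *)
have dmax1 : 1 <= Num.max 1 dmax by rewrite le_max lexx.
set D := Num.max 1 dmax in dmax1.
pose al t := ca * ipow tau1 t; pose gam t := cg * ipow taug t.
have gam0 t : 0 < gam t by rewrite mulr_gt0// ipow_gt0.
have al0 t : 0 < al t by rewrite mulr_gt0// ipow_gt0.
have d0 m : 0 < d m by case/andP: (dP m) => d1 _; apply: lt_le_trans d1.
have sd1 m : 1 <= Num.sqrt (d m).
  by case/andP: (dP m) => d1 _; rewrite -sqrtr1 ler_sqrt// ltW.
have sdD m : Num.sqrt (d m) <= D.
  apply: le_trans (_ : d m <= _); last first.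
    by case/andP: (dP m) => _ d2; rewrite le_max d2 orbT.
  by rewrite -[leRHS]sqr_sqrtr ?(ltW (d0 m))// expr2 ler_peMr.
have sd_sq m : Num.sqrt (d m) ^+ 2 = d m by rewrite sqr_sqrtr// ltW.
pose f t m := Num.sqrt (d m) * e t m.
pose phi t := l2 (f t).
have phi_lo t : l2 (e t) <= phi t.
  rewrite /phi /l2 ler_sqrt ?sum_sqr_ge0//; apply: ler_sum => m _.
  rewrite /f exprMn sd_sq ler_peMl ?sqr_ge0//.
  by case/andP: (dP m).
have phi_hi t : phi t <= D * l2 (e t).
  have D00 : 0 <= D by apply: le_trans dmax1.
  rewrite -(@ler_pXn2r _ 2) ?nnegrE ?mulr_ge0 ?l2_ge0//.
  rewrite exprMn !sqr_l2 mulr_sumr; apply: ler_sum => m _.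
  rewrite /f exprMn; apply: ler_wpM2r; first exact: sqr_ge0.
  by rewrite lerXn2r// nnegrE.
pose inc t m := al t / Num.sqrt (d m) * \sum_p h p m * u t p.
have fE t m : f t.+1 m = f t m + inc t m.
  rewrite /f eE /inc mulrDr -/(al t); congr (_ + _).
  rewrite mulrA; congr (_ * _).
  have aux (x s : R) : s != 0 -> s * (x / s ^+ 2) = x / s by move=> s0; field.
  rewrite -[RHS]aux ?sd_sq//.
  by rewrite gt_eqF// (lt_le_trans _ (sd1 m)).
pose C1 := #|T|%:R * #|S|%:R + 1 : R.
have C10 : 0 < C1 by rewrite ltr_wpDl// mulr_ge0.
have incB t : l2 (inc t) <= C1 * al t * gam t.
  have : l2 (inc t) <= #|T|%:R * (al t * (#|S|%:R * gam t)).
    apply: l2_le_max => m; rewrite /inc normrM; apply: ler_pM => //.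
      rewrite ger0_norm; last by rewrite divr_ge0 ?(ltW (al0 t))// sqrtr_ge0.
      rewrite ler_pdivrMr; last by rewrite (lt_le_trans _ (sd1 m)).
      by rewrite ler_peMr// ltW.
    apply: (le_trans (ler_norm_sum _ _ _)).
    apply: le_trans (_ : \sum_(p : S) gam t <= _); last first.
      by rewrite sumr_const mulr_natl.
    apply: ler_sum => p _; rewrite normrM -[leRHS]mul1r ler_pM//.
    by have := normr_le_l2 (h p) m; rewrite /l2 h1 sqrtr1.
  move=> hB; apply: (le_trans hB).
  have : 0 <= al t * gam t by rewrite mulr_ge0// ltW.
  by rewrite /C1; clear; lra.
suff [K KP] : exists K, forall t, phi t <= K * ipow taug t.
  by exists K => t; apply: le_trans (KP t).
pose kap := (lam - Delta) / 2.
have kap0 : 0 < kap by rewrite divr_gt0// subr_gt0.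
have lam0 : 0 < lam by apply: le_lt_trans Dlam.
have D1 : 0 < D by apply: lt_le_trans dmax1.
apply: (@trapped_sequence R ca cg tau1 taug D C1 (kap / D / 2)) => //.
- exact: ltW.
- by rewrite divr_gt0// divr_gt0.
- by move=> t; exact: l2_ge0.
- near=> t; rewrite -/(al t) -/(gam t) /phi (eq_l2 (fE t)).
  by apply: (le_trans (l2_triangle _ _)); rewrite lerD2l.
(* Chosen so that the terms in [eta] consume at most half of the gap [lam - Delta]; [kap] is the
   other half. *)
pose eta := kap / (lam + #|S|%:R + 1).
have L0 : 0 < lam + #|S|%:R + 1 by rewrite ltr_wpDl// addr_ge0// ltW.
have eta0 : 0 < eta by rewrite divr_gt0.
have c' : 0 < kap / D / 2 * ca by rewrite mulr_gt0// divr_gt0// divr_gt0.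
near=> t; rewrite -/(al t) -/(gam t) => Dphi.
have ge : gam t <= l2 (e t).
  by rewrite -(ler_pM2l D1); apply: le_trans (phi_hi t).
have del : forall p, ~~ A p -> `|delta t p| <= eta * gam t.
  by near: t; exact: delS.
have := innovation_drift (gam0 t) (ltW eta0) (ltW lam0) ge h1 (ug t) (uE t) del
  (lamP (e t)) (DelP (u t) (gam t) (ltW (gam0 t)) (ug t)).
have bracket : kap <= lam * (1 - eta) - Delta - #|S|%:R * eta.
  have : eta * (lam + #|S|%:R + 1) = kap by rewrite /eta divfK// gt_eqF.
  have kE : 2 * kap = lam - Delta by rewrite /kap mulrC divfK.
  by have := eta0; move: kE; clearbody eta kap; clear; lra.
set Q := \sum_p _ => drift.
have drift2 : Q <= - (gam t * l2 (e t) * kap).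
  apply: (le_trans drift); rewrite lerN2 ler_wpM2l//.
  by rewrite mulr_ge0 ?l2_ge0// ltW.
have sqphi : phi t.+1 ^+ 2 = phi t ^+ 2 + 2 * al t * Q + l2 (inc t) ^+ 2.
  rewrite !sqr_l2 /Q mulr_sumr.
  under eq_bigr do rewrite fE.
  have -> : \sum_p 2 * al t * ((\sum_m h p m * e t m) * u t p) =
      \sum_m 2 * f t m * inc t m.
    transitivity (\sum_m \sum_p 2 * al t * (h p m * e t m * u t p)).
      rewrite exchange_big; apply: eq_bigr => p _.
      by rewrite mulr_suml mulr_sumr.
    apply: eq_bigr => m _; rewrite /f /inc.
    have sd0 : Num.sqrt (d m) != 0 by rewrite gt_eqF// (lt_le_trans _ (sd1 m)).
    have -> : 2 * (Num.sqrt (d m) * e t m) *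
        (al t / Num.sqrt (d m) * \sum_p h p m * u t p) =
        2 * al t * e t m * \sum_p h p m * u t p by field.
    by rewrite mulr_sumr; apply: eq_bigr => p _; ring.
  by rewrite -!big_split/=; apply: eq_bigr => m _; ring.
have alsmall : C1 ^+ 2 * al t <= kap.
  rewrite /al mulrA -ler_pdivlMl ?mulr_gt0 ?exprn_gt0//.
  by near: t; apply: near_ipow_le => //; rewrite mulr_gt0// invr_gt0 mulr_gt0// exprn_gt0.
have alsmall2 : kap / D / 2 * al t <= 1.
  rewrite /al mulrA -ler_pdivlMl// mulr1.
  by near: t; apply: near_ipow_le; rewrite // invr_gt0.
(* The first-order term is at most minus twice this bound, so for small [al t] the second-order term
   costs only half of it. *)
have incsq : l2 (inc t) ^+ 2 <= kap * al t * gam t * l2 (e t).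
  apply: le_trans (_ : (C1 * al t * gam t) ^+ 2 <= _).
    rewrite lerXn2r// nnegrE ?l2_ge0//.
    by apply: le_trans (incB t); exact: l2_ge0.
  have -> : (C1 * al t * gam t) ^+ 2 = C1 ^+ 2 * al t * (al t * gam t) * gam t.
    by ring.
  have -> : kap * al t * gam t * l2 (e t) = kap * (al t * gam t) * l2 (e t).
    by ring.
  have ag : 0 <= al t * gam t by rewrite mulr_ge0// ltW.
  apply: ler_pM => //.
  - by rewrite mulr_ge0// mulr_ge0 ?exprn_ge0 ?(ltW C10)// ltW.
  - exact: ltW.
  - by rewrite ler_wpM2r.
have phi' : phi t.+1 ^+ 2 <= phi t ^+ 2 - kap * al t * gam t * l2 (e t).
  have := ler_wpM2l (ltW (al0 t)) drift2.
  by rewrite sqphi; move: incsq; clear; lra.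
(* As phi <= D l2(e), the decrease of the square is at least 2 a phi; so the new square is at most
   (phi - a)^2, and a <= phi allows taking roots. *)
set a := kap / D / 2 * al t * gam t.
have a0 : 0 <= a.
  by rewrite mulr_ge0 ?(ltW (gam0 t))// mulr_ge0 ?(ltW (al0 t))// divr_ge0// divr_ge0// ltW.
have aphi : a <= phi t.
  apply: le_trans (phi_lo t); apply: le_trans ge.
  by rewrite /a -[leRHS]mul1r ler_wpM2r// ltW.
have phi'' : phi t.+1 ^+ 2 <= (phi t - a) ^+ 2.
  apply: (le_trans phi').
  have : 2 * a * phi t <= kap * al t * gam t * l2 (e t).
    apply: le_trans (_ : 2 * a * (D * l2 (e t)) <= _).
      by rewrite ler_wpM2l// mulr_ge0.
    have -> : 2 * a * (D * l2 (e t)) = kap * al t * gam t * l2 (e t).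
      by rewrite /a; field; rewrite gt_eqF.
    by [].
  by have := sqr_ge0 a; clear; lra.
by rewrite ler_pXn2r ?nnegrE ?l2_ge0// ?subr_ge0 in phi''.
Unshelve. all: by end_near. Qed.

(** * Rate of convergence of averaged noise *)

Section independent_products.
Context {d : measure_display} {T : measurableType d} {R : realType}.
Variable P : probability T R.

Lemma Lfun2_integral_sqr (X : T -> R) : measurable_fun setT X ->
  (\int[P]_x (X x ^+ 2)%:E < +oo)%E -> X \in Lfun P 2%:E.
Proof.
move=> mX Xoo; rewrite inE; apply/andP; split; first by rewrite inE.
rewrite inE/= /finite_norm.
have : ('N[P]_2%:E[EFin \o X] `^ 2 < +oo)%E.
  rewrite powR_Lnorm ?pnatr_eq0//; apply: le_lt_trans Xoo.
  rewrite le_eqVlt; apply/orP; left; apply/eqP; apply: eq_integral => x _.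
  transitivity (`|X x|%:E `^ 2)%E => //.
  by rewrite poweR_EFin powR_mulrn// real_normK ?num_real.
by move/lty_poweRy; apply; rewrite pnatr_eq0.
Qed.

(** The joint distribution and the product of the marginals agree on rectangles, hence everywhere;
    Fubini's theorem then splits the integral, the product being integrable because both factors are
    square integrable. *)
Lemma expectation_mul_independent (X Y : T -> R) :
  X \in Lfun P 2%:E -> Y \in Lfun P 2%:E ->
  (forall A B, measurable A -> measurable B ->
     P (X @^-1` A `&` Y @^-1` B) = (P (X @^-1` A) * P (Y @^-1` B))%E) ->
  ('E_P[(X * Y)%R] = 'E_P[X] * 'E_P[Y])%E.
Proof.
move=> X2 Y2 ind.
have Pfin : P setT \is a fin_num by rewrite probability_setT.
have X1 := Lfun_subset12 Pfin X2.
have Y1 := Lfun_subset12 Pfin Y2.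
have XY1 := Lfun2_mul_Lfun1 X2 Y2.
have mX : X \in mfun by have := sub_Lfun_mfun X2.
have mY : Y \in mfun by have := sub_Lfun_mfun Y2.
have mX' : measurable_fun setT X by move: mX; rewrite inE.
have mY' : measurable_fun setT Y by move: mY; rewrite inE.
pose Z w := (X w, Y w).
have mZ' : measurable_fun setT Z by exact: measurable_fun_pair.
have mZ : Z \in mfun by rewrite inE.
pose X' := mfun_Sub mX; pose Y' := mfun_Sub mY; pose Z' := mfun_Sub mZ.
pose m1 := distribution P X'; pose m2 := distribution P Y'.
pose m' := distribution P Z'.
have prodE (A : set (R * R)%type) : measurable A -> (m1 \x m2)%E A = m' A.
  by apply: product_measure_unique => B C mB mC; rewrite /m' /m1 /m2 /distribution
    /pushforward/= -ind.
pose f (z : R * R) : \bar R := (z.1 * z.2)%:E.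
have mf : measurable_fun setT f.
  by apply/measurable_EFinP; apply: measurable_funM.
have fZ : P.-integrable setT (f \o Z') by exact/Lfun1_integrable.
have if' : m'.-integrable setT f by exact: integrable_pushforward.
have intf : (m1 \x m2)%E.-integrable setT f.
  move/integrableP : if' => [_ h]; apply/integrableP; split => //.
  rewrite (eq_measure_integral m') // => A mA _; exact: prodE.
have -> : ('E_P[(X * Y)%R] = \int[m1 \x m2]_z f z)%E.
  rewrite (eq_measure_integral m'); last by move=> A mA _; exact: prodE.
  by rewrite /m' integral_distribution// unlock.
rewrite -integral12_prod_meas1//.
have iY : m2.-integrable setT (fun y : R => y%:E).
  apply: integrable_pushforward => //; last exact/Lfun1_integrable.
  by apply/measurable_EFinP.
have iX : m1.-integrable setT (fun y : R => y%:E).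
  apply: integrable_pushforward => //; last exact/Lfun1_integrable.
  by apply/measurable_EFinP.
have EY : (\int[m2]_y y%:E = 'E_P[Y])%E.
  have i1 : P.-integrable setT ((fun y : R => y%:E) \o Y').
    exact/Lfun1_integrable.
  by rewrite /m2 integral_distribution//; rewrite unlock.
have EX : (\int[m1]_y y%:E = 'E_P[X])%E.
  have i1 : P.-integrable setT ((fun y : R => y%:E) \o X').
    exact/Lfun1_integrable.
  by rewrite /m1 integral_distribution//; rewrite unlock.
have EYf : 'E_P[Y]%E \is a fin_num by exact: expectation_fin_num.
transitivity (\int[m1]_x ((fine 'E_P[Y])%:E * x%:E))%E.
  apply: eq_integral => x _; rewrite /fubini_F/= /f/=.
  under eq_integral do rewrite EFinM.
  by rewrite integralZl// EY muleC fineK.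
by rewrite integralZl// EX fineK// muleC.
Qed.

End independent_products.

Section block_sums.
Context {R : realDomainType}.

Definition block_sum (x : nat -> R) s n := \sum_(s <= j < s + n) x j.

(* [(k + 1) * dyadic_energy x k s] dominates the square of every partial sum
   of [x] starting at [s] of length at most [2 ^ k]: such a sum is made of at
   most [k + 1] dyadic blocks, at distinct scales. *)
Fixpoint dyadic_energy (x : nat -> R) k s : R :=
  if k is k'.+1 then
    block_sum x s (2 ^ k')%N ^+ 2 + dyadic_energy x k' s
    + dyadic_energy x k' (s + 2 ^ k')%N
  else x s ^+ 2.

Lemma block_sumS (x : nat -> R) s n :
  block_sum x s n.+1 = block_sum x s n + x (s + n)%N.
Proof. by rewrite /block_sum addnS big_nat_recr//= leq_addr. Qed.

Lemma block_sumD (x : nat -> R) s m n :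
  block_sum x s (m + n) = block_sum x s m + block_sum x (s + m) n.
Proof.
by rewrite /block_sum addnA (@big_cat_nat _ _ _ (s + m))//= leq_addr.
Qed.

Lemma dyadic_energy_ge0 (x : nat -> R) k s : 0 <= dyadic_energy x k s.
Proof.
by elim: k s => [|k IH] s /=; rewrite ?addr_ge0// sqr_ge0.
Qed.

Lemma block_sum_sqr_le (x : nat -> R) k s n : (n <= 2 ^ k)%N ->
  block_sum x s n ^+ 2 <= k.+1%:R * dyadic_energy x k s.
Proof.
elim: k s n => [|k IH] s n.
  rewrite expn0 leq_eqVlt ltnS leqn0 => /orP[/eqP->|/eqP->].
    by rewrite block_sumS /block_sum big_geq ?addn0// add0r mul1r.
  by rewrite /block_sum addn0 big_geq// expr0n mul1r/= sqr_ge0.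
have [n2 _|n2] := leqP n (2 ^ k).
  apply: (le_trans (IH s n n2)); apply: ler_pM => //.
  - exact: dyadic_energy_ge0.
  - by rewrite ler_nat.
  - by rewrite /= -addrA addrCA lerDl addr_ge0 ?sqr_ge0 ?dyadic_energy_ge0.
rewrite expnS mul2n -addnn => nle.
have nE : n = (2 ^ k + (n - 2 ^ k))%N by rewrite subnKC// ltnW.
rewrite nE block_sumD; set B := block_sum x s (2 ^ k).
have : (n - 2 ^ k <= 2 ^ k)%N by rewrite leq_subLR.
move=> /(IH (s + 2 ^ k)%N); rewrite /= -/B.
set r := block_sum _ _ _; set U := dyadic_energy _ _ _ => rU.
set U' := dyadic_energy x k s.
have U'0 : 0 <= U' by exact: dyadic_energy_ge0.
rewrite -natr1; set K : R := k.+1%:R in rU *.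
have K0 : 0 < K by rewrite ltr0n.
rewrite -(ler_pM2l K0).
(* Cauchy-Schwarz with weights 1 and K: (B + r)^2 <= (K + 1) (B^2 + r^2 / K), where r^2 <= K U. Each
   scale thus adds one to the constant. *)
have := sqr_ge0 (K * B - r).
have : (K + 1) * r ^+ 2 <= (K + 1) * (K * U).
  by rewrite ler_wpM2l// addr_ge0// ltW.
have : 0 <= K * (K + 1) * U' by rewrite !mulr_ge0// ?addr_ge0// ltW.
lra.
Qed.

End block_sums.

(** With [s] the cube root of [q], one factor s^k is kept and the other two absorb the square of k +
    1, since (k + 1) s^k is bounded by Bernoulli's inequality. *)
Lemma polynomial_geometric_bound (R : realType) (q : R) : 0 < q -> q < 1 ->
  exists2 s : R, 0 < s < 1 &
    exists2 C : R, 0 < C & forall k, k.+1%:R ^+ 2 * q ^+ k <= C * s ^+ k.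
Proof.
move=> q0 q1; pose s := q `^ 3^-1.
have s0 : 0 < s by rewrite powR_gt0.
have s3 : s ^+ 3 = q.
  by rewrite -powR_mulrn ?powR_ge0// -powRrM mulVf ?pnatr_eq0// powRr1// ltW.
have s1 : s < 1.
  rewrite ltNge; apply/negP => s1; move: q1; rewrite -s3 ltNge => /negP; apply.
  by rewrite exprn_ege1.
exists s; first by rewrite s0.
pose h := s^-1 - 1.
have h0 : 0 < h by rewrite subr_gt0 invf_gt1.
exists ((1 + h^-1) ^+ 2) => [|k].
  by rewrite exprn_gt0// addr_gt0// invr_gt0.
have lin : k.+1%:R * s ^+ k <= 1 + h^-1.
  have := bernoulli_ineq k (ltW h0); rewrite /h subrKC -/h exprVn => b.
  have sk : 0 < s ^+ k by exact: exprn_gt0.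
  have kb : k.+1%:R <= (1 + h^-1) * (1 + k%:R * h).
    have hi : 0 < h^-1 by rewrite invr_gt0.
    have -> : (1 + h^-1) * (1 + k%:R * h) = 1 + k%:R + (k%:R * h + h^-1).
      by field; rewrite gt_eqF.
    by rewrite -natr1 addrC lerDl addr_ge0 ?(ltW hi)// mulr_ge0// ltW.
  rewrite -ler_pdivlMr//; apply: (le_trans kb).
  by rewrite ler_wpM2l// addr_ge0// invr_ge0 ltW.
rewrite -s3 -exprM mulnC exprM.
have -> : k.+1%:R ^+ 2 * (s ^+ k) ^+ 3 = (k.+1%:R * s ^+ k) ^+ 2 * s ^+ k by ring.
rewrite ler_wpM2r ?exprn_ge0 ?(ltW s0)// lerXn2r// nnegrE.
  by rewrite mulr_ge0// exprn_ge0// ltW.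
by rewrite addr_ge0// invr_ge0 ltW.
Qed.

Section uncorrelated_sums.
Context {d : measure_display} {T : measurableType d} {R : realType}.
Variables (P : probability T R) (X : nat -> T -> R) (v : R).

Definition orthogonal_of_second_moment :=
  [/\ forall i, X i \in Lfun P 2%:E,
      forall i, ('E_P[(X i * X i)%R] = v%:E)%E &
      forall i j, i != j -> ('E_P[(X i * X j)%R] = 0)%E].

Hypothesis HX : orthogonal_of_second_moment.
Local Notation B s n := (fun w => block_sum (X ^~ w) s n).

Let Pfin : P setT \is a fin_num.
Proof. by rewrite probability_setT. Qed.

Let BS s n : B s n.+1 = (B s n + X (s + n)%N)%R.
Proof. by apply/funext => w; rewrite block_sumS. Qed.

Let B0 s : B s 0 = cst 0.
Proof. by apply/funext => w; rewrite /block_sum addn0 big_geq. Qed.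

Lemma block_sum_Lfun2 s n : B s n \in Lfun P 2%:E.
Proof.
case: HX => X2 _ _; elim: n => [|n IH].
  by rewrite B0; exact: Lfun_cst.
by rewrite BS rpredD// lee1n.
Qed.

Lemma block_sum_orthogonal s n j : (s + n <= j)%N ->
  ('E_P[((B s n : T -> R) * X j)%R] = 0)%E.
Proof.
case: HX => X2 _ Xij; elim: n => [|n IH] sj.
  rewrite B0; have -> : (cst 0 * X j)%R = cst 0.
    by apply/funext => w; rewrite fctE mul0r.
  by rewrite expectation_cst.
rewrite BS mulrDl expectationD ?Lfun2_mul_Lfun1 ?block_sum_Lfun2//.
rewrite IH; last by apply: leq_trans sj; rewrite leq_add2l.
by rewrite Xij ?adde0// ltn_eqF// -addnS.
Qed.

Lemma block_sum_second_moment s n :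
  ('E_P[((B s n : T -> R) * B s n)%R] = (n%:R * v)%:E)%E.
Proof.
case: (HX) => X2 Xv _; elim: n => [|n IH].
  rewrite B0; have -> : (cst 0 * cst 0)%R = cst 0 :> (T -> R).
    by apply/funext => w; rewrite fctE mul0r.
  by rewrite expectation_cst mul0r.
have b2 := block_sum_Lfun2 s n.
rewrite BS mulrDl !mulrDr [(X _ * B s n)%R]mulrC.
rewrite !expectationD ?rpredD ?Lfun2_mul_Lfun1//.
rewrite IH Xv block_sum_orthogonal// !add0e ?adde0 -EFinD.
by rewrite -natr1 mulrDl mul1r.
Qed.

Lemma dyadic_energy_Lfun1 k s :
  (fun w => dyadic_energy (X ^~ w) k s) \in Lfun P 1.
Proof.
case: HX => X2 _ _; elim: k s => [|k IH] s.
  have -> : (fun w => dyadic_energy (X ^~ w) 0 s) = (X s * X s)%R.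
    by apply/funext => w; rewrite /= expr2.
  exact: Lfun2_mul_Lfun1.
have -> : (fun w => dyadic_energy (X ^~ w) k.+1 s) =
    ((B s (2 ^ k) : T -> R) * B s (2 ^ k) +
     (fun w => dyadic_energy (X ^~ w) k s) +
     (fun w => dyadic_energy (X ^~ w) k (s + 2 ^ k)%N))%R.
  by apply/funext => w; rewrite /= expr2.
by rewrite !rpredD// Lfun2_mul_Lfun1// block_sum_Lfun2.
Qed.

(** Blocks of a given size are disjoint, so at each of the [k + 1] scales the second moments add up
    to at most 2^k v. *)
Lemma expectation_dyadic_energy k s :
  ('E_P[fun w => dyadic_energy (X ^~ w) k s] <= (k.+1%:R * 2 ^+ k * v)%:E)%E.
Proof.
case: (HX) => X2 Xv _; elim: k s => [|k IH] s.
  have -> : (fun w => dyadic_energy (X ^~ w) 0 s) = (X s * X s)%R.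
    by apply/funext => w; rewrite /= expr2.
  by rewrite Xv expr0 !mul1r.
have -> : (fun w => dyadic_energy (X ^~ w) k.+1 s) =
    ((B s (2 ^ k) : T -> R) * B s (2 ^ k) +
     (fun w => dyadic_energy (X ^~ w) k s) +
     (fun w => dyadic_energy (X ^~ w) k (s + 2 ^ k)%N))%R.
  by apply/funext => w; rewrite /= expr2.
have v0 : 0 <= v.
  rewrite -lee_fin -(Xv 0%N); apply: expectation_ge0 => w.
  by rewrite fctE -expr2 sqr_ge0.
rewrite !expectationD ?rpredD ?dyadic_energy_Lfun1//; last 2 first.
- by rewrite Lfun2_mul_Lfun1// block_sum_Lfun2.
- by rewrite Lfun2_mul_Lfun1// block_sum_Lfun2.
rewrite block_sum_second_moment.
apply: le_trans (leeD (leeD (lexx _) (IH s)) (IH _)) _.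
rewrite -!EFinD lee_fin natrX exprS -[k.+2%:R]natr1.
have : 0 <= 2 ^+ k * v by rewrite mulr_ge0// exprn_ge0.
move=> h; have -> : (k.+1%:R + 1) * (2 * 2 ^+ k) * v =
  2 ^+ k * v + k.+1%:R * 2 ^+ k * v + k.+1%:R * 2 ^+ k * v + 2 ^+ k * v by ring.
by rewrite lerDl.
Qed.
End uncorrelated_sums.

Lemma two_pow_le_powR (R : realType) (p : R) n m : 0 <= p -> (2 ^ n <= m)%N ->
  (2 `^ p) ^+ n <= m%:R `^ p.
Proof.
move=> p0 nm; rewrite -powR_mulrn ?powR_ge0// powRAC powR_mulrn//.
by rewrite ge0_ler_powR ?nnegrE// ?exprn_ge0// -natrX ler_nat.
Qed.

(** The square of every partial sum of at most 2^k terms is dominated by f_k b^(2k), for b = 2^(1 -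
    tau). Since tau < 1/2, b^2 > 2 beats the growth 2^k of the variance; the expectations of f_k are
    summable, and f_k tends to 0 almost surely. One null set serves all [eta]. *)
Lemma time_average_rate d (T : measurableType d) (R : realType)
    (P : probability T R) (X : nat -> T -> R) (v tau : R) :
  orthogonal_of_second_moment P X v -> 0 <= tau -> tau < 2^-1 ->
  {ae P, forall w, forall eta : R, 0 < eta ->
     \forall t \near \oo,
       `|t.+1%:R^-1 * \sum_(j < t.+1) X j w| <= eta * ipow tau t}.
Proof.
move=> HX tau0 tauh.
have v0 : 0 <= v.
  case: HX => _ Xv _; rewrite -lee_fin -(Xv 0%N).
  by apply: expectation_ge0 => w; rewrite fctE -expr2 sqr_ge0.
pose b : R := 2 `^ (1 - tau).
have b0 : 0 < b by rewrite powR_gt0.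
have b2 : 2 < b ^+ 2.
  rewrite -powR_mulrn ?powR_ge0// -powRrM -[ltLHS](powRr1 (ler0n _ _)).
  rewrite /powR pnatr_eq0/= ltr_expR ltr_pM2r ?ln_gt0 ?ltr1n//; lra.
have b20 : 0 < b ^+ 2 by exact: exprn_gt0.
pose q := 2 / b ^+ 2.
have q0 : 0 < q by rewrite divr_gt0.
have q1 : q < 1 by rewrite ltr_pdivrMr// mul1r.
have [s /andP[s0 s1] [C C0 hC]] := polynomial_geometric_bound q0 q1.
pose f k w := k.+1%:R * (b ^+ 2) ^- k * dyadic_energy (X ^~ w) k 0.
have c0 k : 0 <= k.+1%:R * (b ^+ 2) ^- k.
  by rewrite mulr_ge0// invr_ge0 exprn_ge0// ltW.
have f0 k w : 0 <= f k w by rewrite mulr_ge0// dyadic_energy_ge0.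
have fL k : f k \in Lfun P 1.
  have -> : f k = (k.+1%:R * (b ^+ 2) ^- k) \o*
      (fun w => dyadic_energy (X ^~ w) k 0).
    by apply/funext => w; rewrite /f/= mulrC.
  by apply: Lfun_scale => //; exact: (dyadic_energy_Lfun1 HX).
have Ef k : (\int[P]_w (f k w)%:E <= (C * v * s ^+ k)%:E)%E.
  have -> : (\int[P]_w (f k w)%:E = (k.+1%:R * (b ^+ 2) ^- k)%:E *
      'E_P[fun w => dyadic_energy (X ^~ w) k 0])%E.
    rewrite -expectationZl; last exact: (dyadic_energy_Lfun1 HX).
    by rewrite unlock; apply: eq_integral => w _; rewrite /f/= mulrC.
  apply: le_trans (lee_wpmul2l _ (expectation_dyadic_energy HX k 0)) _.
    by rewrite lee_fin.
  rewrite -EFinM lee_fin.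
  have -> : k.+1%:R * (b ^+ 2) ^- k * (k.+1%:R * 2 ^+ k * v) =
      k.+1%:R ^+ 2 * q ^+ k * v.
    by rewrite /q expr_div_n; ring.
  by rewrite [leRHS]mulrAC ler_wpM2r.
have mf k : measurable_fun setT (fun w => (f k w)%:E).
  by apply/measurable_EFinP; have := sub_Lfun_mfun (fL k); rewrite inE.
have sumfin : (\int[P]_w (\sum_(k <oo) (f k w)%:E) < +oo)%E.
  rewrite integral_nneseries//; last by move=> k w _; rewrite lee_fin.
  apply: (@le_lt_trans _ _ (C * v / (1 - s))%:E); last exact: ltry.
  apply: lime_le; first by apply: is_cvg_nneseries => k _ _; apply: integral_ge0 => w _; rewrite lee_fin.
  apply: nearW => n; apply: le_trans (lee_sum _ (fun k _ => Ef k)) _.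
  rewrite sumEFin lee_fin -mulr_sumr; apply: ler_wpM2l.
    by rewrite mulr_ge0// ltW.
  rewrite -[leRHS]mul1r ler_pdivlMr ?subr_gt0// mulrC big_mkord.
  have := subrX1 s n; rewrite -[s - 1]opprB mulNr => /(congr1 -%R).
  by rewrite opprK opprB => <-; rewrite lerBlDr lerDl exprn_ge0// ltW.
have : P.-integrable setT (fun w => \sum_(k <oo) (f k w)%:E)%E.
  apply/integrableP; split.
    by apply: ge0_emeasurable_sum => // k w _ _; rewrite lee_fin.
  apply: le_lt_trans sumfin; rewrite le_eqVlt; apply/orP; left; apply/eqP.
  apply: eq_integral => w _; rewrite gee0_abs// nneseries_ge0// => k _ _.
  by rewrite lee_fin.
move=> /(integrable_ae measurableT); apply: filterS => w /(_ I) fin eta eta0.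
have fcvg : (fun k => f k w) @ \oo --> (0 : R).
  apply: cvg_series_cvg_0; apply: nnseries_is_cvg => //.
  by rewrite -ge0_fin_numE// nneseries_ge0// => k _ _; rewrite lee_fin.
(* The division by b^2 pays for rounding t + 1 up to 2^k: it is b^(k - 1) that is at most (t + 1)^(1
   - tau). *)
have e1 : 0 < eta ^+ 2 / b ^+ 2 by rewrite divr_gt0// exprn_gt0.
have /cvgr0Pnorm_le/(_ _ e1)[K _ hK] := fcvg.
exists (2 ^ K)%N => // t Kt.
set k := (trunc_log 2 t.+1).+1.
have Kk : (K <= k)%N.
  rewrite leqNgt; apply/negP => kK.
  have := trunc_log_ltn t.+1 (ltnSn 1); rewrite -/k ltnNge => /negP; apply.
  apply: leq_trans (leqnSn _); apply: leq_trans Kt.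
  by rewrite leq_exp2l// ltnW.
have tk : (t.+1 <= 2 ^ k)%N by rewrite ltnW// trunc_log_ltn.
have kt : (2 ^ k.-1 <= t.+1)%N by rewrite trunc_logP.
have := block_sum_sqr_le (X ^~ w) 0 tk; rewrite /block_sum add0n big_mkord.
set S := \sum_(j < t.+1) _ => SU.
have fk : f k w <= eta ^+ 2 / b ^+ 2.
  by have := hK k Kk; rewrite /= ger0_norm.
have S2 : S ^+ 2 <= (eta * b ^+ k.-1) ^+ 2.
  apply: (le_trans SU).
  have -> : k.+1%:R * dyadic_energy (X ^~ w) k 0 = f k w * (b ^+ 2) ^+ k.
    by rewrite /f mulrAC divfK// expf_neq0// gt_eqF.
  have -> : (eta * b ^+ k.-1) ^+ 2 = eta ^+ 2 / b ^+ 2 * (b ^+ 2) ^+ k.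
    have kE : k = k.-1.+1 by [].
    rewrite [in RHS]kE [(b ^+ 2) ^+ _.+1]exprS mulrA divfK ?gt_eqF//.
    by rewrite exprMn [_ ^+ k.-1 ^+ 2]exprAC.
  by rewrite ler_wpM2r// exprn_ge0// ltW.
have bt : b ^+ k.-1 <= t.+1%:R `^ (1 - tau).
  by apply: two_pow_le_powR => //; lra.
have Sle : `|S| <= eta * t.+1%:R `^ (1 - tau).
  apply: le_trans (_ : eta * b ^+ k.-1 <= _); last by rewrite ler_wpM2l// ltW.
  rewrite -(@ler_pXn2r _ 2) ?nnegrE//.
    by rewrite real_normK ?num_real.
  by rewrite mulr_ge0 ?exprn_ge0// ltW.
rewrite normrM ger0_norm ?invr_ge0// ler_pdivrMl//.
apply: (le_trans Sle); rewrite le_eqVlt; apply/orP; left; apply/eqP.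
rewrite mulrCA; congr (_ * _); rewrite /ipow powRD ?pnatr_eq0 ?implybT//.
by rewrite powRr1.
Unshelve. all: by end_near. Qed.

(** * Random graphs *)

Lemma measurable_mx_entry (R : realType) m n (i : 'I_m) (j : 'I_n) :
  measurable_fun setT (fun A : 'M[R]_(m, n) => A i j).
Proof.
move=> _ B mB; apply: sub_sigma_algebra; exists (i, j) => //.
by exists B.
Qed.

Lemma measurable_mxP d (T : measurableType d) (R : realType) m n
    (f : T -> 'M[R]_(m, n)) :
  measurable_fun setT f <->
  forall i j, measurable_fun setT (fun x => f x i j).
Proof.
split=> [mf i j|mf].
  exact: (measurableT_comp (measurable_mx_entry i j) mf).
apply: (@measurability _ _ T 'M[R]_(m, n) setT f
  (\bigcup_(ij in [set: 'I_m * 'I_n])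
     preimage_set_system setT (fun A : 'M[R]_(m, n) => A ij.1 ij.2)
       measurable)) => //.
move=> _ [_ [[i j] _ [B mB <-]] <-].
by have := mf i j measurableT B mB; rewrite !setTI.
Qed.

Section edges.
Context {R : realType} {N : nat}.
Implicit Types e : rel 'I_N.

Lemma laplacian_edge e i j : i != j -> (laplacian e i j != 0 :> R) = e i j.
Proof.
by rewrite mxE => /negbTE ->; case: (e i j); rewrite ?oppr0 ?eqxx// oppr_eq0 oner_eq0.
Qed.

End edges.

Section random_graph.
Context {R : realType} {d : measure_display} {Omega : measurableType d}.
Variable P : probability Omega R.
Variable N : nat.
Variable G : nat -> Omega -> rel 'I_N.
Local Notation L t := (fun w => laplacian (G t w) : 'M[R]_N).
Hypothesis G_irr : forall t w, irreflexive (G t w).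
Hypothesis L_meas : forall t, measurable_fun [set: Omega] (L t).
Hypothesis L_iid : iid P (fun t w => laplacian (G t w) : 'M[R]_N).

Definition edge t (i j : 'I_N) := [set w | G t w i j].

(** The diagonal of a Laplacian holds degrees, not edge indicators, so the case [i == j], where
    [G_irr] forbids an edge, is included by hand. *)
Let no_edge (i j : 'I_N) : set 'M[R]_N := [set A | i == j \/ A i j = 0].

Let no_edgeE t i j : ~` edge t i j = L t @^-1` no_edge i j.
Proof.
apply/seteqP; split => w /=; rewrite /edge /no_edge/=.
  have [->|ij] := eqVneq i j; first by left.
  by move=> h; right; apply/eqP; apply: contra_notT h; rewrite laplacian_edge.
case=> [/eqP->|L0]; first by rewrite G_irr.
have [->|ij] := eqVneq i j; first by rewrite G_irr.
by apply/negP; rewrite -(@laplacian_edge R)// L0 eqxx.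
Qed.

Let measurable_no_edge i j : measurable (no_edge i j).
Proof.
have [->|ij] := eqVneq i j.
  have -> : no_edge j j = setT by apply/seteqP; split => // A _; left.
  exact: measurableT.
have -> : no_edge i j = (fun A : 'M[R]_N => A i j) @^-1` [set 0].
  apply/seteqP; split => A /=; rewrite /no_edge/=; last by right.
  by case=> // /eqP ijE; rewrite ijE eqxx in ij.
rewrite -[X in measurable X]setTI.
exact: (measurable_mx_entry i j measurableT).
Qed.

Lemma measurable_edge t i j : measurable (edge t i j).
Proof.
rewrite -[edge _ _ _]setCK; apply: measurableC; rewrite no_edgeE.
by rewrite -[X in measurable X]setTI; exact: L_meas.
Qed.

Let no_edge_prob (i j : 'I_N) (J : seq nat) : uniq J ->
  P (\bigcap_(t in [set` J]) ~` edge t i j) =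
  ((fine (P (~` edge 0 i j))) ^+ size J)%:E.
Proof.
move=> uJ; have [ind id] := L_iid.
pose F : {fset nat} := [fset t in J]%fset.
have -> : [set` J] = [set` F].
  by apply/seteqP; split => t /=; rewrite inE.
rewrite (ind F (fun t => ~` edge t i j)); last first.
  move=> t _; rewrite no_edgeE; exists (no_edge i j).
    exact: measurable_no_edge.
  by rewrite setTI.
have pE t : P (~` edge t i j) = (fine (P (~` edge 0 i j)))%:E.
  rewrite fineK; last exact: fin_num_measure (measurableC (measurable_edge _ _ _)).
  by rewrite !no_edgeE id//; exact: measurable_no_edge.
under eq_bigr do rewrite pE.
rewrite big_const_seq count_predT.
have -> : size F = size J by rewrite card_fseq undup_id.
elim: (size J) => [|n IH] /=; first by rewrite expr0.
by rewrite IH exprS EFinM.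
Qed.

Lemma sum_inv_sqr_le n : \sum_(t < n) (t.+1%:R ^- 2 : R) <= 2.
Proof.
suff : \sum_(t < n) (t.+1%:R ^- 2 : R) <= 2 - 2 / n.+1%:R.
  move/le_trans; apply; rewrite lerBlDr lerDl divr_ge0//.
elim: n => [|n IH]; first by rewrite big_ord0 divr1 subrr.
rewrite big_ord_recr/=; apply: (le_trans (lerD IH (lexx _))).
have a0 : 0 < (n.+1%:R : R) by rewrite ltr0n.
rewrite -[n.+2%:R]natr1; move: a0 (ler0n R n); rewrite -[n.+1%:R]natr1.
set a : R := n%:R => a1 a0.
rewrite -subr_ge0.
have -> : 2 - 2 / (a + 1 + 1) - (2 - 2 / (a + 1) + (a + 1) ^- 2) =
    a / ((a + 1) ^+ 2 * (a + 1 + 1)).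
  by field; rewrite !gt_eqF// ltr_wpDl.
by rewrite divr_ge0// mulr_ge0 ?sqr_ge0// !addr_ge0.
Qed.

(** Borel-Cantelli: if p is the probability of absence and p^K <= 1/4, a window of K (log t + 1)
    steps, with the truncated binary logarithm, misses the edge with probability at most (t + 1)^-2.
    Windows overlap, but summability is enough. The form for all large [K] lets finitely many edges
    share one window length. *)
Lemma edge_recurs (i j : 'I_N) : P (edge 0 i j) != 0%E ->
  exists K0, forall K, (K0 <= K)%N ->
    {ae P, forall w, \forall t \near \oo,
       exists2 q, (q < K * (trunc_log 2 t).+1)%N &
         G (t - K * (trunc_log 2 t).+1 + q)%N w i j}.
Proof.
move=> Pij; pose p := fine (P (~` edge 0 i j)).
have pE : P (~` edge 0 i j) = p%:E.
  by rewrite fineK// fin_num_measure//; apply/measurableC/measurable_edge.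
have p0 : 0 <= p by exact: fine_ge0.
have p1 : p < 1.
  rewrite -lte_fin -pE probability_setC; last exact: measurable_edge.
  have Pf : P (edge 0 i j) \is a fin_num.
    exact: fin_num_measure (measurable_edge _ _ _).
  rewrite -(fineK Pf) -EFinB lte_fin gtrBl fine_gt0// lt0e Pij measure_ge0/=.
  by rewrite -ge0_fin_numE.
have : (fun n => p ^+ n) @ \oo --> (0 : R) by apply: cvg_expr; rewrite ger0_norm.
move=> /cvgr0Pnorm_le/(_ (1 / 4)); rewrite divr_gt0// => /(_ isT)[K0 _ hK].
exists K0 => K /hK/=; rewrite ger0_norm ?exprn_ge0// => pK.
pose T t := (K * (trunc_log 2 t).+1)%N.
(* For small [t] the subtraction is truncated and the window starts at 0; its length remains
   [T t]. *)
pose E t := \bigcap_(r in [set` iota (t - T t) (T t)]) ~` edge r i j.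
have mE t : measurable (E t).
  apply: fin_bigcap_measurable; first exact: finite_seq.
  by move=> r _; apply/measurableC/measurable_edge.
have PE t : (P (E t) <= (t.+1%:R ^- 2)%:E)%E.
  rewrite no_edge_prob ?iota_uniq// size_iota lee_fin -/p /T exprM.
  set l := (trunc_log 2 t).+1.
  apply: le_trans (_ : (1 / 4) ^+ l <= _).
    by rewrite lerXn2r// nnegrE ?exprn_ge0// divr_ge0.
  have tl : (t.+1 <= 2 ^ l)%N by exact: trunc_log_ltn.
  have -> : (1 / 4 : R) = 2 ^- 2 by rewrite -natrX div1r.
  rewrite exprVn -exprM mulnC exprM lef_pV2 ?posrE ?exprn_gt0//.
  by rewrite lerXn2r ?nnegrE ?exprn_ge0// -natrX ler_nat.
exists (lim_sup_set E); split.
- by apply: bigcap_measurable => // n _; apply: bigcup_measurable => k _; exact: mE.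
- apply: lim_sup_set_cvg0 => //; apply: (@le_lt_trans _ _ 2%:E); last exact: ltry.
  apply: lime_le; first by apply: is_cvg_nneseries => *; exact: measure_ge0.
  apply: nearW => n; apply: le_trans (lee_sum _ (fun k _ => PE k)) _.
  by rewrite sumEFin lee_fin big_mkord sum_inv_sqr_le.
- move=> w /= h n _; apply: contrapT => nE; apply: h; exists n => // t nt.
  have : ~ E t w by move=> Et; apply: nE; exists t.
  move/existsNP => [r /not_implyP[]].
  rewrite /= mem_iota => /andP[tr rt] /contrapT ge.
  exists (r - (t - T t))%N; last by rewrite subnKC.
  by rewrite -/(T t) ltn_subLR.
Qed.

Lemma edges_recur : exists2 K, (0 < K)%N &
  {ae P, forall w, \forall t \near \oo, forall i j, P (edge 0 i j) != 0%E ->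
     exists2 q, (q < K * (trunc_log 2 t).+1)%N &
       G (t - K * (trunc_log 2 t).+1 + q)%N w i j}.
Proof.
have hK (ij : 'I_N * 'I_N) : exists K0, P (edge 0 ij.1 ij.2) != 0%E ->
    forall K, (K0 <= K)%N -> {ae P, forall w, \forall t \near \oo,
       exists2 q, (q < K * (trunc_log 2 t).+1)%N &
         G (t - K * (trunc_log 2 t).+1 + q)%N w ij.1 ij.2}.
  have [P0|Pij] := eqVneq (P (edge 0 ij.1 ij.2)) 0%E; first by exists 0%N.
  by have [K0 h] := edge_recurs Pij; exists K0 => _.
have [f fP] := choice hK.
exists (\max_ij f ij).+1 => //.
have : {ae P, forall w, forall ij : 'I_N * 'I_N, P (edge 0 ij.1 ij.2) != 0%E ->
     \forall t \near \oo,
     exists2 q, (q < (\max_ij f ij).+1 * (trunc_log 2 t).+1)%N &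
       G (t - (\max_ij f ij).+1 * (trunc_log 2 t).+1 + q)%N w ij.1 ij.2}.
  apply: filter_forall => ij.
  have [P0|Pij] := eqVneq (P (edge 0 ij.1 ij.2)) 0%E; first by apply: nearW.
  have := fP ij Pij (\max_ij f ij).+1 (leqW (leq_bigmax ij)).
  by apply: filterS => w.
apply: filterS => w h.
have : \forall t \near \oo, forall ij : 'I_N * 'I_N, P (edge 0 ij.1 ij.2) != 0%E ->
     exists2 q, (q < (\max_ij f ij).+1 * (trunc_log 2 t).+1)%N &
       G (t - (\max_ij f ij).+1 * (trunc_log 2 t).+1 + q)%N w ij.1 ij.2.
  apply: filter_forall => ij.
  have [P0|Pij] := eqVneq (P (edge 0 ij.1 ij.2)) 0%E; first by apply: nearW.
  by apply: filterS (h ij Pij).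
by apply: filterS => t ht i j; exact: (ht (i, j)).
Qed.

End random_graph.

Lemma laplacian_bform (R : realType) k (p : 'I_k -> 'I_k -> R) (A : 'M[R]_k) :
  (forall i j, p i j = p j i) ->
  (forall i j, A i j = (if i == j then \sum_l p i l else 0) - p i j) ->
  forall v, bform A v v = (\sum_i \sum_j p i j * (v i 0 - v j 0) ^+ 2) / 2.
Proof.
move=> sp AE v; rewrite bformE.
have -> : \sum_i \sum_j v i 0 * A i j * v j 0 =
    \sum_i \sum_j (p i j * v i 0 ^+ 2 - p i j * (v i 0 * v j 0)).
  apply: eq_bigr => i _; transitivity
    (\sum_j ((if i == j then (\sum_l p i l) * v i 0 ^+ 2 else 0) -
             p i j * (v i 0 * v j 0))).
    apply: eq_bigr => j _; rewrite AE; case: eqP => [<-|_]; ring.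
  rewrite !sumrB; congr (_ - _).
  rewrite (bigD1 i)//= eqxx [X in _ + X]big1 ?addr0 ?mulr_suml// => j /negbTE.
  by rewrite eq_sym => ->.
have E : \sum_i \sum_j (p i j * v i 0 ^+ 2 - p i j * (v i 0 * v j 0)) =
    \sum_i \sum_j (p i j * v j 0 ^+ 2 - p i j * (v i 0 * v j 0)).
  rewrite exchange_big; apply: eq_bigr => i _; apply: eq_bigr => j _.
  by rewrite sp; ring.
apply: (@mulIf _ 2); rewrite ?pnatr_eq0// divfK ?pnatr_eq0//.
rewrite mulr_natr mulr2n [in X in _ + X]E -big_split/=.
apply: eq_bigr => i _; rewrite -big_split/=.
by apply: eq_bigr => j _; ring.
Qed.

Lemma card_pred_natr (R : pzSemiRingType) (T : finType) (A : pred T) :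
  #|A|%:R = \sum_x (A x)%:R :> R.
Proof.
by rewrite -sum1_card natr_sum big_mkcond; apply: eq_bigr => x _;
  rewrite unfold_in; case: ifP.
Qed.

Section mean_laplacian.
Context {R : realType} {d : measure_display} {Omega : measurableType d}.
Variables (P : probability Omega R) (N M : nat).
Variables (I : 'I_N -> {set 'I_M}) (G : nat -> Omega -> rel 'I_N).
Hypothesis G_sym : forall t w, symmetric (G t w).
Hypothesis G_irr : forall t w, irreflexive (G t w).
Hypothesis mG : forall i j, measurable (edge G 0 i j).

Let prob i j : R := fine (P (edge G 0 i j)).

Let edge_fin i j : P (edge G 0 i j) \is a fin_num.
Proof. exact: fin_num_measure. Qed.

Let probC i j : prob i j = prob j i.
Proof.
by rewrite /prob /edge; congr (fine (P _)); apply/seteqP; split => w /=; rewrite G_sym.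
Qed.

Let probii i : prob i i = 0.
Proof.
rewrite /prob /edge (_ : [set w | _] = set0) ?measure0//.
by apply/seteqP; split => w //=; rewrite G_irr.
Qed.

Let expectation_edge i j : 'E_P[fun w => (G 0 w i j)%:R]%E = (prob i j)%:E.
Proof.
have -> : (fun w => (G 0 w i j)%:R : R) = \1_(edge G 0 i j).
  by apply/funext => w; rewrite indicE /edge mem_setE.
by rewrite expectation_indic// /prob fineK.
Qed.

Let edge_Lfun1 i j : (fun w => (G 0 w i j)%:R : R) \in Lfun P 1.
Proof.
have -> : (fun w => (G 0 w i j)%:R : R) = \1_(edge G 0 i j).
  by apply/funext => w; rewrite indicE /edge mem_setE.
apply/Lfun1_integrable; exact: integrable_indic.
Qed.

Lemma expectation_induced_laplacian m (i j : 'I_#|interested I m|) :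
  expectation_mx P (fun w => induced_laplacian I (G 0 w) m : 'M[R]__) i j =
  (if i == j then
     \sum_(l < #|interested I m|) prob (enum_val i) (enum_val l) else 0) -
  prob (enum_val i) (enum_val j).
Proof.
rewrite mxE; have [<-|ij] := eqVneq i j.
  rewrite probii subr0.
  have -> : (fun w => (induced_laplacian I (G 0 w) m : 'M[R]__) i i) =
      \sum_(f <- [seq (fun w => (G 0 w (enum_val i) (enum_val l))%:R) |
                  l <- index_enum 'I_#|interested I m|]) f.
    apply/funext => w; rewrite mxE eqxx big_map fct_sumE.
    exact: card_pred_natr.
  rewrite expectation_sum; last first.
    by move=> f /mapP[l _ ->]; exact: edge_Lfun1.
  by rewrite big_map; under eq_bigr do rewrite expectation_edge; rewrite sumEFin.
rewrite sub0r.
have -> : (fun w => (induced_laplacian I (G 0 w) m : 'M[R]__) i j) =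
    (-1) \o* (fun w => (G 0 w (enum_val i) (enum_val j))%:R).
  by apply/funext => w; rewrite mxE (negbTE ij)/= mulrN1.
by rewrite expectationZl// expectation_edge -EFinM mulN1r.
Qed.

(** Replacing each positive edge probability by 1 only enlarges the quadratic form of the mean
    Laplacian, so the inequality survives on the graph of edges of positive probability, which recur
    on almost every path. With at most one vertex, a zero-sum [v] is 0. *)
Lemma connected_poincare m :
  ((1 < #|interested I m|)%N ->
     0 < lambda2 (expectation_mx P (fun w => induced_laplacian I (G 0 w) m))) ->
  exists2 c : R, 0 < c & forall v : 'I_#|interested I m| -> R,
    \sum_i v i = 0 ->
    c * \sum_i v i ^+ 2 <=
    \sum_i \sum_(j | P (edge G 0 (enum_val i) (enum_val j)) != 0%E)
      (v i - v j) ^+ 2.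
Proof.
move=> conn; have [k1|k1] := leqP #|interested I m| 1.
  exists 1 => // v v0; rewrite mul1r big1 => [|i _].
    by apply: sumr_ge0 => i _; apply: sumr_ge0 => j _; exact: sqr_ge0.
  have vi : \sum_j v j = v i.
    rewrite (bigD1 i)//= big1 ?addr0// => j /eqP ji; case: ji.
    apply/val_inj => /=; have := ltn_ord i; have := ltn_ord j; move: k1.
    by case: #|_| i j => [|[|]] // [[]] // ? [[]].
  by rewrite -vi v0 expr0n.
pose A : 'M[R]_#|interested I m| :=
  expectation_mx P (fun w => induced_laplacian I (G 0 w) m).
pose p (i j : 'I_#|interested I m|) := prob (enum_val i) (enum_val j).
have AE i j : A i j = (if i == j then \sum_l p i l else 0) - p i j.
  exact: expectation_induced_laplacian.
have pC i j : p i j = p j i by exact: probC.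
have sA : A^T = A.
  by apply/matrixP => i j; rewrite mxE !AE [in RHS]eq_sym pC; case: eqP => // ->.
have p0 i j : 0 <= p i j by rewrite /p fine_ge0.
have p1 i j : p i j <= 1.
  by rewrite /p -lee_fin fineK// probability_le1.
have bA := laplacian_bform pC AE.
have A0 v : 0 <= bform A v v.
  rewrite bA divr_ge0//; apply: sumr_ge0 => i _; apply: sumr_ge0 => j _.
  by rewrite mulr_ge0// sqr_ge0.
have A1 : A *m const_mx 1 = (0 : 'cV_#|interested I m|).
  apply/matrixP => i j; rewrite !mxE.
  under eq_bigr do rewrite AE mxE mulr1.
  rewrite sumrB (bigD1 i)//= eqxx [X in _ + X - _]big1 ?addr0 ?subrr//.
  by move=> l /negbTE; rewrite eq_sym => ->.
have [c c0 hc] := lambda2_poincare sA A0 A1 (conn k1).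
exists c => // v v0.
have := hc (\col_i v i); rewrite bform1 bA.
under eq_bigr do rewrite mxE.
rewrite v0 => /(_ erefl).
under [X in c * X <= _]eq_bigr do rewrite mxE -expr2.
move/le_trans; apply.
set S := (X in _ <= X).
have S0 : 0 <= S by apply: sumr_ge0 => i _; apply: sumr_ge0 => j _; exact: sqr_ge0.
apply: (@le_trans _ _ (S / 2)); last by rewrite ler_pdivrMr// ler_peMr// ler1n.
rewrite ler_pM2r ?invr_gt0//; apply: ler_sum => i _.
rewrite [leRHS]big_mkcond/=; apply: ler_sum => j _; rewrite !mxE.
have [P0|_] := eqVneq (P _) 0%E; first by rewrite /p /prob P0 mul0r.
by rewrite /= ler_piMl// sqr_ge0.
Qed.

End mean_laplacian.

(** * Resilience along a sample path *)

Lemma graph_flow_sum0 (R : realType) (V : finType) (J : {set V}) (g : rel V)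
    (x : V -> R) : symmetric g ->
  \sum_(n in J) \sum_(l in J | g n l) (x n - x l) = 0.
Proof.
move=> sg; set S := (X in X = 0).
have E : S = - S.
  rewrite {1}/S; under eq_bigr do rewrite big_mkcondr.
  rewrite exchange_big/= /S -sumrN; apply: eq_bigr => n _.
  rewrite big_mkcondr -sumrN; apply: eq_bigr => l _.
  by rewrite sg; case: ifP => _; rewrite ?oppr0// opprB.
lra.
Qed.

(** A deterministic statement in coordinates: [ag p] is the agent owning stream [p], [E] holds the
    recurrent edges, [T] the window lengths. On the streams in [A] the readings [ybar] are
    arbitrary, which covers any attack, even one that depends on the graphs. *)
Lemma resilient_path (R : realType) (N M : nat) (S : finType)
    (ag : S -> 'I_N) (h : S -> 'I_M -> R) (J : 'I_M -> {set 'I_N})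
    (A : pred S) (theta : 'I_M -> R) (X : nat -> 'I_N -> 'I_M -> R)
    (ybar : nat -> S -> R) (G : nat -> rel 'I_N) (E : rel 'I_N)
    (T : nat -> nat) (ca cb cg tau1 tau2 taug lam Delta : R) :
  0 < ca -> 0 < cb -> 0 < cg ->
  0 < tau2 -> tau2 < tau1 -> 0 < taug -> taug < 1 - tau1 ->
  (forall t, symmetric (G t)) ->
  (forall m, (0 < #|J m|)%N) ->
  (forall p m, h p m != 0 -> ag p \in J m) ->
  (forall p, \sum_m h p m ^+ 2 = 1) ->
  (forall t n m, n \in J m -> X t.+1 n m = X t n m
     - cb * ipow tau2 t * (\sum_(l in J m | G t n l) (X t n m - X t l m))
     + ca * ipow tau1 t * \sum_(p | ag p == n) h p m *
         (let i := ybar t p - \sum_m' h p m' * X t (ag p) m' in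
          gain (cg * ipow taug t) i * i)) ->
  (forall m, exists2 c : R, 0 < c & forall v : 'I_#|J m| -> R,
     \sum_i v i = 0 -> c * \sum_i v i ^+ 2 <=
     \sum_i \sum_(j | E (enum_val i) (enum_val j)) (v i - v j) ^+ 2) ->
  (forall t, (0 < T t)%N) ->
  (forall e : R, 0 < e ->
     exists2 D : R, 0 < D & forall t, (T t)%:R <= D * ipow (- e) t) ->
  (\forall t \near \oo, forall i j, E i j ->
     exists2 q, (q < T t)%N & G (t - T t + q)%N i j) ->
  (forall p, ~~ A p -> forall eta : R, 0 < eta -> \forall t \near \oo,
     `|ybar t p - \sum_m h p m * theta m| <= eta * ipow taug t) ->
  (forall v : 'I_M -> R,
     lam * \sum_m v m ^+ 2 <= \sum_(p | ~~ A p) (\sum_m h p m * v m) ^+ 2) ->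
  (forall (v : S -> R) (B : R), 0 <= B -> (forall p, `|v p| <= B) ->
     l2 (fun m => \sum_(p | A p) h p m * v p) <= Delta * B) ->
  0 <= Delta -> Delta < lam ->
  forall n m, n \in J m ->
    exists K, forall t, `|X t n m - theta m| <= K * ipow taug t.
Proof.
move=> ca0 cb0 cg0 t20 t21 tg0 tglt Gsym J0 hJ h1 XE poinc T0 Tsmall cover.
move=> noise lamP DelP D0 Dlam.
pose inn t p := ybar t p - \sum_m' h p m' * X t (ag p) m'.
pose u t p := gain (cg * ipow taug t) (inn t p) * inn t p.
have gam0 t : 0 <= cg * ipow taug t by rewrite mulr_ge0 ?ipow_ge0// ltW.
have al0 t : 0 <= ca * ipow tau1 t by rewrite mulr_ge0 ?ipow_ge0// ltW.
have uB t p : `|u t p| <= cg * ipow taug t by exact: gain_mulr_le.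
have hB p m : `|h p m| <= 1.
  by have := normr_le_l2 (h p) m; rewrite /l2 h1 sqrtr1.
pose dm m : R := #|J m|%:R.
have dm0 m : 0 < dm m by rewrite ltr0n.
pose xbar t m := (dm m)^-1 * \sum_(n in J m) X t n m.
have huB t m (Q : pred S) : `|\sum_(p | Q p) h p m * u t p| <=
    #|S|%:R * (cg * ipow taug t).
  rewrite big_mkcond; apply: (le_trans (ler_norm_sum _ _ _)).
  apply: le_trans (_ : \sum_(p : S) cg * ipow taug t <= _); last first.
    by rewrite sumr_const mulr_natl.
  apply: ler_sum => p _; case: ifP => _; last by rewrite normr0.
  by rewrite normrM -[leRHS]mul1r ler_pM.
have xbarE t m : xbar t.+1 m =
    xbar t m + ca * ipow tau1 t / dm m * \sum_p h p m * u t p.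
  have -> : ca * ipow tau1 t / dm m * \sum_p h p m * u t p =
      (dm m)^-1 * (ca * ipow tau1 t * \sum_p h p m * u t p).
    by rewrite mulrAC mulrC.
  rewrite /xbar -mulrDr; congr (_ * _).
  rewrite (eq_bigr _ (fun n => XE t n m)) big_split/= big_split/=.
  rewrite sumrN -mulr_sumr graph_flow_sum0// mulr0 subr0; congr (_ + _).
  rewrite -mulr_sumr; congr (_ * _).
  (* Streams owned outside [J m] do not see component [m]; each of the others is counted once, at
     its owner. *)
  rewrite [RHS](bigID (fun p => ag p \in J m))/= [X in _ = _ + X]big1 ?addr0.
    rewrite (partition_big ag (mem (J m)))//=; apply: eq_bigr => n nJ.
    by apply: eq_bigl => p; case: eqP => [->|_]; rewrite ?nJ ?andbF.
  move=> p pJ; suff -> : h p m = 0 by rewrite mul0r.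
  by apply/eqP; apply: contraNT pJ => /hJ.
pose e t m := xbar t m - theta m.
have eE t m : e t.+1 m =
    e t m + ca * ipow tau1 t / dm m * \sum_p h p m * u t p.
  by rewrite /e xbarE; ring.
pose z m t (i : 'I_#|J m|) := X t (enum_val i) m - xbar t m.
have zsum m t : \sum_i z m t i = 0.
  rewrite /z sumrB -(big_enum_val (fun n => X t n m)) sumr_const card_ord.
  by rewrite -mulr_natl /xbar mulVKf ?subrr// gt_eqF// dm0.
have zdecay m : exists rho K : R,
    taug < rho /\ forall t, l2 (z m t) <= K * ipow rho t.
  pose g t (i j : 'I_#|J m|) := G t (enum_val i) (enum_val j).
  pose w t (i : 'I_#|J m|) := ca * ipow tau1 t *
    (\sum_(p | ag p == enum_val i) h p m * u t p -
     (dm m)^-1 * \sum_p h p m * u t p).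
  have [c c0 hc] := poinc m.
  apply: (@consensus_decay R _ cb tau1 tau2 taug
    (#|J m|%:R * (ca * (2 * (#|S|%:R * cg)))) g (z m) w T
    (fun i j => E (enum_val i) (enum_val j)) c) => //.
  - by rewrite !mulr_ge0// ltW.
  - by move=> t i j; rewrite /g Gsym.
  - move=> t i; rewrite /z XE ?enum_valP// xbarE /consensus /graph_lap /w.
    rewrite big_enum_val_cond/=.
    have -> : \sum_(l < #|J m| | g t i l)
        (X t (enum_val i) m - xbar t m - (X t (enum_val l) m - xbar t m)) =
      \sum_(l < #|J m| | G t (enum_val i) (enum_val l))
        (X t (enum_val i) m - X t (enum_val l) m).
      by apply: eq_bigr => l _; ring.
    by rewrite /u /inn/=; ring.
  - move=> t; have -> : #|J m|%:R * (ca * (2 * (#|S|%:R * cg))) *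
        ipow (tau1 + taug) t = #|'I_#|J m| |%:R *
        (ca * ipow tau1 t * (2 * (#|S|%:R * (cg * ipow taug t)))).
      by rewrite card_ord ipowD; ring.
    apply: l2_le_max => i; rewrite /w normrM ger0_norm//.
    apply: ler_wpM2l => //; apply: (le_trans (ler_normB _ _)).
    rewrite mulr_natl mulr2n lerD ?huB// normrM ger0_norm ?invr_ge0 ?(ltW (dm0 m))//.
    apply: le_trans (huB t m predT); rewrite ler_piMl// invf_le1 ?ler1n ?J0//.
  - by move=> t; apply: hc.
  - by apply: filterS cover => t ht i j; exact: ht.
(* The deviation of an innovation from its ideal value, minus the inner product of the row with [e]:
   averaged noise plus the owner's disagreement. *)
pose delta t p := inn t p + \sum_m h p m * e t m.
have dsmall eta : 0 < eta -> \forall t \near \oo, forall p, ~~ A p ->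
    `|delta t p| <= eta * (cg * ipow taug t).
  move=> eta0; apply: filter_forall => p.
  have [Ap|nAp] := boolP (A p); first by apply: nearW.
  have eta1 : 0 < eta * cg / (M.+1)%:R.
    by rewrite divr_gt0 ?ltr0n// mulr_gt0.
  have zs : \forall t \near \oo, forall m, `|h p m * (X t (ag p) m - xbar t m)| <=
      eta * cg / M.+1%:R * ipow taug t.
    apply: filter_forall => m.
    (* Where [h p m] vanishes, the owner need not be interested in [m], and [zdecay] gives no
       information. *)
    have [->|hpm] := eqVneq (h p m) 0.
      by apply: nearW => t; rewrite mul0r normr0 mulr_ge0 ?ipow_ge0// ltW.
    have pJ := hJ p m hpm.
    have [rho [K [rhog hK]]] := zdecay m.
    have K1 : 0 < `|K| + 1 by rewrite ltr_wpDl.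
    have := near_ipow_le (_ : 0 < rho - taug) (divr_gt0 eta1 K1).
    rewrite subr_gt0 => /(_ rhog); apply: filterS => t.
    rewrite ler_pdivlMr// => ht.
    rewrite normrM; apply: le_trans (_ : `|X t (ag p) m - xbar t m| <= _).
      by rewrite ler_piMl.
    apply: le_trans (_ : l2 (z m t) <= _).
      have := normr_le_l2 (z m t) (enum_rank_in pJ (ag p)).
      by rewrite /z enum_rankK_in.
    apply: (le_trans (hK t)).
    have -> : ipow rho t = ipow (rho - taug) t * ipow taug t.
      by rewrite -ipowD subrK.
    rewrite mulrA ler_wpM2r ?ipow_ge0//; apply: le_trans ht.
    rewrite mulrC ler_wpM2l ?ipow_ge0//.
    by apply: le_trans (ler_norm K) _; rewrite lerDl.
  have := noise p nAp _ eta1; move: zs.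
  apply: filterS2 => t zs ns _.
  have -> : delta t p = (ybar t p - \sum_m h p m * theta m) -
      \sum_m h p m * (X t (ag p) m - xbar t m).
    rewrite /delta /inn -!addrA; congr (_ + _).
    rewrite -!sumrN -!big_split/=; apply: eq_bigr => m _; rewrite /e; ring.
  apply: (le_trans (ler_normB _ _)).
  have : `|\sum_m h p m * (X t (ag p) m - xbar t m)| <=
      M%:R * (eta * cg / M.+1%:R * ipow taug t).
    apply: (le_trans (ler_norm_sum _ _ _)).
    apply: (le_trans (ler_sum _ (fun m _ => zs m))).
    by rewrite sumr_const card_ord mulr_natl.
  move=> hs; apply: (le_trans (lerD ns hs)).
  rewrite -[X in X + _]mul1r -mulrDl nat1r mulrA mulrCA mulfV ?pnatr_eq0//.
  by rewrite mulr1 mulrA.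
have [Ke hKe] : exists K, forall t, l2 (e t) <= K * ipow taug t.
  apply: (@lyapunov_bound R _ S dm h A ca cg tau1 taug lam Delta N%:R e u delta) => //.
  - by lra.
  - move=> m; rewrite ler1n J0/= ler_nat -[leqRHS]card_ord; exact: max_card.
  - move=> t p nAp /=; rewrite /u /delta.
    by have -> : - (\sum_m h p m * e t m) + (inn t p + \sum_m h p m * e t m) =
      inn t p by ring.
move=> n m nJ; have [rho [K [rhog hK]]] := zdecay m.
exists (`|K| + Ke) => t.
have -> : X t n m - theta m = (X t n m - xbar t m) + e t m by rewrite /e; ring.
apply: (le_trans (ler_normD _ _)); rewrite mulrDl; apply: lerD; last first.
  by apply: le_trans (hKe t); exact: normr_le_l2.
apply: le_trans (_ : l2 (z m t) <= _).
  have := normr_le_l2 (z m t) (enum_rank_in nJ n).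
  by rewrite /z enum_rankK_in.
apply: (le_trans (hK t)); apply: le_trans (_ : `|K| * ipow rho t <= _).
  by rewrite ler_wpM2r ?ipow_ge0// ler_norm.
by rewrite ler_wpM2l// ler_ipow_exp// ltW.
Qed.

(** * The estimator *)

Section coordinates.
Context {R : realType} {N M : nat}.
Variable I : 'I_N -> {set 'I_M}.

(** Extension by zero to all [M] field components, so that estimates of different agents can be
    compared without reindexing. Its body is that of an entry of [censored]. *)
Definition coord n (x : 'cV[R]_#|I n|) (m : 'I_M) : R :=
  if interest_inv I n m is Some r then x r ord0 else 0.

Lemma coord_enum_val n (x : 'cV[R]_#|I n|) r : coord x (enum_val r) = x r 0.
Proof.
rewrite /coord /interest_inv; case: pickP => [r' /eqP/enum_val_inj -> //|/(_ r)].
by rewrite eqxx.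
Qed.

Lemma coord_notin n (x : 'cV[R]_#|I n|) m : m \notin I n -> coord x m = 0.
Proof.
rewrite /coord /interest_inv; case: pickP => // r /eqP <-.
by rewrite enum_valP.
Qed.

Lemma interest_cols_mul n k (A : 'M[R]_(k, M)) (x : 'cV[R]_#|I n|) i :
  (interest_cols I n A *m x) i 0 = \sum_m A i m * coord x m.
Proof.
rewrite mxE (bigID (mem (I n)))/= [X in _ = _ + X]big1 ?addr0; last first.
  by move=> m mI; rewrite coord_notin// mulr0.
rewrite [RHS]big_enum_val; apply: eq_bigr => r _.
by rewrite coord_enum_val mxE.
Qed.

End coordinates.

Section sample_path.
Context {R : realType} {N M : nat} {Pd : 'I_N -> nat}.
Variables (I : 'I_N -> {set 'I_M}) (H : forall n : 'I_N, 'M[R]_(Pd n, M)).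
Variables (alpha beta gamma : nat -> R).
Variables (y : forall n : 'I_N, nat -> 'cV[R]_(Pd n)) (G : nat -> rel 'I_N).
Local Notation stream := 'I_(\sum_(n < N) Pd n).
Local Notation safe := (safe I H alpha beta gamma y G).

Definition innovation t n i : R :=
  time_average y n t i 0 - \sum_m H n i m * coord (safe t n) m.

Lemma safeS_entry t n r : safe t.+1 n r 0 = safe t n r 0
  - beta t * (\sum_(l | G t n l)
      ((if enum_val r \in I l then safe t n r 0 else 0)
       - coord (safe t l) (enum_val r)))
  + alpha t * \sum_i H n i (enum_val r) *
      (gain (gamma t) (innovation t i) * innovation t i).
Proof.
rewrite /= /safe_step -mulmxA !mxE; congr (_ - beta t * _ + alpha t * _).
  by rewrite summxE; apply: eq_bigr => l _; rewrite !mxE.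
apply: eq_bigr => i _; rewrite /gain_mx mul_diag_mx !mxE.
have -> : \sum_j interest_cols I n (H n) i j * safe t n j 0 =
    \sum_m H n i m * coord (safe t n) m.
  by rewrite -interest_cols_mul mxE.
by rewrite /innovation mxE.
Qed.

Lemma sum_streams (F : forall n, 'I_(Pd n) -> R) n :
  \sum_(p : stream | tagnat.sig1 p == n) F (tagnat.sig1 p) (tagnat.sig2 p) =
  \sum_i F n i.
Proof.
transitivity (\sum_(n' | n' == n) \sum_(i < Pd n') F n' i); last first.
  by rewrite big_pred1_eq.
rewrite sig_big_dep/= [RHS](reindex (@tagnat.sig N Pd)); last first.
  exact/onW_bij/tagnat.sig_bij.
by apply: eq_bigl => p; rewrite andbT.
Qed.

(** For a neighbour not interested in [m], the entries of [processed] and [censored] are both 0.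
    Hence consensus decouples into one system per component, on the graph induced by the agents
    interested in it. *)
Lemma safeS_coord t n m : m \in I n -> coord (safe t.+1 n) m =
  coord (safe t n) m
  - beta t * (\sum_(l in interested I m | G t n l)
      (coord (safe t n) m - coord (safe t l) m))
  + alpha t * \sum_(p : stream | tagnat.sig1 p == n) stream_vec H p m 0 *
      (let i := time_average y (tagnat.sig1 p) t (tagnat.sig2 p) 0
                - \sum_m' stream_vec H p m' 0 *
                   coord (safe t (tagnat.sig1 p)) m' in
       gain (gamma t) i * i).
Proof.
move=> mI; rewrite -(enum_rankK_in mI mI) !coord_enum_val safeS_entry.
set r := enum_rank_in mI m; congr (_ - _ * _ + _ * _).
  rewrite [RHS]big_mkcondl; apply: eq_bigr => l _.
  rewrite inE; case: ifP => // rl.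
  by rewrite coord_notin ?rl// subrr.
rewrite -(sum_streams (fun n i => H n i (enum_val r) *
      (gain (gamma t) (innovation t i) * innovation t i))).
apply: eq_bigr => p _.
have hE m' : stream_vec H p m' 0 = H (tagnat.sig1 p) (tagnat.sig2 p) m'.
  by rewrite !mxE.
rewrite hE /=; under eq_bigr do rewrite hE.
by [].
Qed.

End sample_path.

(** * The Gramian and the attack bound [Delta] *)

Section gramian_delta.
Context {R : realType} {N M : nat} {Pd : 'I_N -> nat}.
Local Notation stream := 'I_(\sum_(n < N) Pd n).
Variable H : forall n : 'I_N, 'M[R]_(Pd n, M).

Lemma gramian_sym (S : {set stream}) : (gramian H S)^T = gramian H S.
Proof.
rewrite /gramian linear_sum/=; apply: eq_bigr => p _.
by rewrite trmx_mul trmxK.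
Qed.

Lemma gramian_bform (S : {set stream}) v : bform (gramian H S) v v =
  \sum_(p in S) (\sum_m stream_vec H p m 0 * v m 0) ^+ 2.
Proof.
rewrite /bform /gramian mulmx_sumr mulmx_suml summxE; apply: eq_bigr => p _.
rewrite mulmxA -mulmxA mxE big_ord1 expr2; congr (_ * _).
  by rewrite mxE; apply: eq_bigr => m _; rewrite mxE mulrC.
by rewrite mxE; apply: eq_bigr => m _; rewrite [in LHS]mxE.
Qed.

Lemma attacked_mx_mul (A : {set stream}) (v : 'cV[R]_#|A|) m :
  ((attacked_mx H A)^T *m v) m 0 =
  \sum_(i < #|A|) stream_vec H (enum_val i) m 0 * v i 0.
Proof.
by rewrite mxE; apply: eq_bigr => i _; rewrite /attacked_mx !mxE.
Qed.

Lemma mx_norm_le_entries k (v : 'cV[R]_k) (B : R) : 0 <= B ->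
  (forall i, `|v i 0| <= B) -> `|v| <= B.
Proof.
move=> B0 vB; have -> : `|v| = \big[Num.max/0]_ij `|v ij.1 ij.2|.
  exact: mx_normrE.
apply/bigmax_leP; split=> // -[i j] _ /=.
by rewrite ord1.
Qed.

Lemma entries_le_mx_norm k (v : 'cV[R]_k) i : `|v i 0| <= `|v|.
Proof.
have -> : `|v| = \big[Num.max/0]_ij `|v ij.1 ij.2| by exact: mx_normrE.
by apply/bigmax_geP; right; exists (i, 0).
Qed.

(** [sup] is an upper bound only of a nonempty bounded set; both bounds on [Delta] below rest on
    this. *)
Lemma Delta_has_sup (A : {set stream}) :
  has_sup [set norm2 ((attacked_mx H A)^T *m v) |
             v in [set v : 'cV[R]_#|A| | `|v| <= 1]].
Proof.
split; first by exists (norm2 ((attacked_mx H A)^T *m 0)); exists 0 => //=; rewrite normr0.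
exists (\sum_m \sum_(i < #|A|) `|stream_vec H (enum_val i) m 0|).
move=> _ [v /= v1 <-]; apply: (le_trans (l2_le_l1 _)).
apply: ler_sum => m _; rewrite attacked_mx_mul.
apply: (le_trans (ler_norm_sum _ _ _)); apply: ler_sum => i _.
by rewrite normrM ler_piMr// (le_trans (entries_le_mx_norm v i)).
Qed.

Lemma Delta_ge0 (A : {set stream}) : 0 <= Delta H A.
Proof.
apply: le_trans (_ : norm2 ((attacked_mx H A)^T *m 0) <= _).
  exact: sqrtr_ge0.
apply: sup_upper_bound; first exact: Delta_has_sup.
by exists 0 => //=; rewrite normr0.
Qed.

Lemma Delta_bound (A : {set stream}) (v : stream -> R) (B : R) :
  0 <= B -> (forall p, `|v p| <= B) ->
  l2 (fun m => \sum_(p in A) stream_vec H p m 0 * v p) <= Delta H A * B.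
Proof.
move=> B0 vB; have [BE|Bn0] := eqVneq B 0.
  have v0 p : v p = 0 by apply/eqP; rewrite -normr_le0 -BE.
  rewrite /l2 big1 ?sqrtr0 ?BE ?mulr0// => m _.
  by rewrite big1 ?expr0n// => p _; rewrite v0 mulr0.
have Bp : 0 < B by rewrite lt0r Bn0.
pose w : 'cV[R]_#|A| := \col_i (v (enum_val i) / B).
rewrite (eq_l2 (v := fun m => B * ((attacked_mx H A)^T *m w) m 0)); last first.
  move=> m; rewrite attacked_mx_mul big_enum_val mulr_sumr.
  by apply: eq_bigr => i _; rewrite [w i 0]mxE [RHS]mulrCA [B * _]mulrC divfK.
rewrite l2_scale// mulrC ler_wpM2r//.
apply: sup_upper_bound; first exact: Delta_has_sup.
exists w => //=; apply: mx_norm_le_entries => // i.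
by rewrite mxE normrM normfV (ger0_norm B0) ler_pdivrMr// mul1r.
Qed.

End gramian_delta.

(** * Measurability of the estimates and of the convergence event *)

Section measurability.
Context {R : realType} {d : measure_display} {Omega : measurableType d}.

Lemma measurable_gain_mul (g : R) (f : Omega -> R) : 0 <= g ->
  measurable_fun setT f -> measurable_fun setT (fun w => gain g (f w) * f w).
Proof.
move=> g0 mf; rewrite (_ : (fun w => _) = (cst (- g)) \max (cst g \min f)).
  by apply: measurable_maxr => //; exact: measurable_minr.
by apply/funext => w; rewrite gain_mulr.
Qed.

Lemma measurable_cvg0 (f : nat -> Omega -> R) :
  (forall t, measurable_fun setT (f t)) ->
  measurable [set w | f ^~ w @ \oo --> (0 : R)].
Proof.
move=> mf.
have -> : [set w | f ^~ w @ \oo --> (0 : R)] =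
    \bigcap_k \bigcup_n \bigcap_(t in [set t | (n <= t)%N])
      (f t @^-1` [set x | `|x| <= k.+1%:R^-1]).
  apply/seteqP; split => w /=.
    move=> /cvgr0Pnorm_le fw k _.
    by have [|n _ hn] := fw k.+1%:R^-1; [rewrite invr_gt0|exists n].
  move=> h; apply/cvgr0Pnorm_le => e e0.
  have [k ke] : exists k, (k.+1%:R^-1 : R) <= e.
    have [n _ hn] := near_ipow_le ltr01 e0.
    by exists n; rewrite -ipow1; apply: hn => /=.
  have [n _ hn] := h k I; exists n => // t nt.
  by apply: le_trans ke; exact: hn.
apply: bigcapT_measurable => k; apply: bigcupT_measurable => n.
apply: bigcap_measurable; [by exists n => /=|move=> t _].
rewrite -[X in measurable X]setTI; apply: mf => //.
have -> : [set x : R | `|x| <= k.+1%:R^-1] = `[- k.+1%:R^-1, k.+1%:R^-1]%classic.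
  by apply/seteqP; split => x /=; rewrite in_itv/= ler_norml.
exact: measurable_itv.
Qed.

Lemma ae_probability1 (P : probability Omega R) (E : set Omega) :
  measurable E -> {ae P, forall w, E w} -> P E = 1%E.
Proof.
move=> mE [B [mB PB0 sub]].
have PC : P (~` E) = 0%E.
  apply/eqP; rewrite eq_le measure_ge0 andbT -PB0.
  by apply: le_measure => //; rewrite inE//; exact: measurableC.
by rewrite -[E]setCK probability_setC ?PC ?sube0//; exact: measurableC.
Qed.

Context {N M : nat} {Pd : 'I_N -> nat}.
Variables (I : 'I_N -> {set 'I_M}) (H : forall n : 'I_N, 'M[R]_(Pd n, M)).
Variables (alpha beta gamma : nat -> R).
Variables (y : forall n : 'I_N, nat -> Omega -> 'cV[R]_(Pd n)).
Variable (G : nat -> Omega -> rel 'I_N).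
Hypothesis gamma_ge0 : forall t, 0 <= gamma t.
Hypothesis my : forall n t i, measurable_fun setT (fun w => y n t w i 0).
Hypothesis mG : forall t i j, measurable (edge G t i j).
Local Notation safe w :=
  (safe I H alpha beta gamma (fun n t => y n t w) (fun t => G t w)).

(** The conclusion being about the probability of an event, that event must be measurable. The sum
    over a random neighbourhood is rewritten as a sum over all agents with edge indicators as
    weights. *)
Lemma measurable_safe t n r : measurable_fun setT (fun w => safe w t n r 0).
Proof.
elim: t n r => [|t IH] n r.
  rewrite (_ : (fun w => _) = cst 0); first exact: measurable_cst.
  by apply/funext => w; rewrite /= mxE.
have mc l m : measurable_fun setT (fun w => coord (safe w t l) m).
  by rewrite /coord; case: interest_inv => [q|]; [exact: IH|exact: measurable_cst].
under eq_fun do rewrite safeS_entry.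
apply: measurable_funD.
  apply: measurable_funB; first exact: IH.
  apply: measurable_funM; first exact: measurable_cst.
  under eq_fun do rewrite big_mkcond.
  apply: measurable_sum => l.
  rewrite (_ : (fun w => _) = (fun w => \1_(edge G t n l) w *
    ((if enum_val r \in I l then safe w t n r 0 else 0) -
     coord (safe w t l) (enum_val r)))); last first.
    apply/funext => w; rewrite indicE; case: ifPn => Gw.
      by rewrite mem_set ?mul1r.
    by rewrite memNset ?mul0r//; exact/negP.
  apply: measurable_funM; first exact: measurable_indic.
  apply: measurable_funB => //.
  by case: (enum_val r \in I l); [exact: IH|exact: measurable_cst].
apply: measurable_funM; first exact: measurable_cst.
apply: measurable_sum => i; apply: measurable_funM; first exact: measurable_cst.
apply: measurable_gain_mul => //; rewrite /innovation.
apply: measurable_funB; last first.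
  apply: measurable_sum => m; apply: measurable_funM => //.
rewrite (_ : (fun w => _) = (fun w => t.+1%:R^-1 * \sum_(j < t.+1) y n j w i 0)).
  apply: measurable_funM; first exact: measurable_cst.
  exact: measurable_sum.
by apply/funext => w; rewrite /time_average !mxE summxE.
Qed.

End measurability.

Lemma iid_entry_orthogonal d (Omega : measurableType d) (R : realType)
    (P : probability Omega R) k (w : nat -> {RV P >-> 'cV[R]_k}) (i : 'I_k)
    (v : R) :
  iid P w ->
  (forall t, 'E_P[fun omega => w t omega i ord0]%E = 0%E) ->
  (forall t, covariance P (fun omega => w t omega i ord0)
                          (fun omega => w t omega i ord0) = v%:E) ->
  orthogonal_of_second_moment P (fun t omega => w t omega i ord0) v.
Proof.
move=> [ind _] mean cov; pose X t omega := w t omega i ord0.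
have mX t : measurable_fun setT (X t).
  exact: (measurable_mxP (w t)).1 (measurable_funPT (w t)) i ord0.
have XX t : 'E_P[(X t * X t)%R]%E = v%:E.
  have meanX : 'E_P[X t]%E = 0%E by exact: mean.
  rewrite -(cov t) covariance.unlock -/(X t) meanX /=.
  have -> // : (X t \- cst 0)%R = X t.
  by apply/funext => omega; rewrite /= subr0.
(* The integral of a square always makes sense in the extended reals, so the finite covariance, with
   mean zero, yields square integrability. *)
have X2 t : X t \in Lfun P 2%:E.
  apply: Lfun2_integral_sqr => //; apply: (@le_lt_trans _ _ v%:E); last exact: ltry.
  rewrite -(XX t) unlock le_eqVlt; apply/orP; left; apply/eqP.
  by apply: eq_integral => omega _; rewrite expr2.
split => // s t st; rewrite -/(X s) -/(X t).
rewrite expectation_mul_independent//; first by rewrite mean mul0e.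
move=> A B mA mB.
pose C r : set 'cV[R]_k :=
  (fun M : 'cV[R]_k => M i ord0) @^-1` (if r == s then A else B).
have mC r : measurable (C r).
  rewrite -[X in measurable X]setTI; apply: measurable_mx_entry => //.
  by case: ifP.
have := ind [fset s; t]%fset (fun r => w r @^-1` C r).
have -> : \bigcap_(r in [set` [fset s; t]%fset]) (w r @^-1` C r) =
    X s @^-1` A `&` X t @^-1` B.
  apply/seteqP; split => omega /=.
    move=> h; have := h s; have := h t; rewrite /= !inE !eqxx orbT /C /=.
    by rewrite eqxx eq_sym (negbTE st) => /(_ isT) ? /(_ isT).
  move=> [As Bt] r; rewrite /= !inE /C /= => /orP[/eqP->|/eqP->].
    by rewrite eqxx.
  by rewrite eq_sym (negbTE st).
move=> ->; last first.
  by move=> r _; exists (C r) => //; rewrite setTI.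
rewrite big_fsetU1/= ?inE// big_seq_fset1 /C /= eqxx.
by rewrite [t == s]eq_sym (negbTE st).
Qed.

Theorem theorem3p1
  (R : realType) (d : measure_display) (Omega : measurableType d)
  (P : probability Omega R)
  (N M : nat) (Pd : 'I_N -> nat)
  (theta : 'cV[R]_M)
  (H : forall n : 'I_N, 'M[R]_(Pd n, M))
  (Sigma : forall n : 'I_N, 'M[R]_(Pd n))
  (I : 'I_N -> {set 'I_M})
  (w a : forall n : 'I_N, nat -> {RV P >-> 'cV[R]_(Pd n)})
  (G : nat -> Omega -> rel 'I_N)
  (A : {set 'I_(\sum_(n < N) Pd n)})
  (ca cb cg tau1 tau2 taug : R)
  (w_iid : forall n, iid P (w n))
  (w_mean : forall n t i, 'E_P[fun omega => w n t omega i ord0]%E = 0%E)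
  (w_cov : forall n t i j,
     covariance P (fun omega => w n t omega i ord0)
                  (fun omega => w n t omega j ord0) = (Sigma n i j)%:E)
  (w_agents : mutually_independent P (fun n => salgebra_of_process (w n)))
  (h_unit : forall p, norm2 (stream_vec H p) = 1)
  (observable : gramian H [set: 'I_(\sum_(n < N) Pd n)]%SET \in unitmx)
  (A_compromised :
     {ae P, forall omega, compromised (fun n t => a n t omega) = A})
  (A_card : (#|A| < \sum_(n < N) Pd n)%N)
  (I_coupling : forall n m, col m (H n) != 0 -> m \in I n)
  (I_cover : forall m, (0 < #|interested I m|)%N)
  (G_sym : forall t omega, symmetric (G t omega))
  (G_irr : forall t omega, irreflexive (G t omega))
  (L_meas : forall t,
     measurable_fun [set: Omega]
       (fun omega => laplacian (G t omega) : 'M[R]_N))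
  (L_iid : iid P (fun t omega => laplacian (G t omega) : 'M[R]_N))
  (L_noise : independent2 P
     (salgebra_of_process (fun t omega => laplacian (G t omega) : 'M[R]_N))
     <<s \bigcup_n salgebra_of_process (w n) >>)
  (L_connected : forall m t, (1 < #|interested I m|)%N ->
     0 < lambda2 (expectation_mx P
                    (fun omega => induced_laplacian I (G t omega) m)))
  (ca_gt0 : 0 < ca) (cb_gt0 : 0 < cb) (cg_gt0 : 0 < cg)
  (tau2_gt0 : 0 < tau2) (tau21 : tau2 < tau1) (tau1_lt1 : tau1 < 1)
  (taug_gt0 : 0 < taug)
  (taug_lt : taug < Num.min (2^-1) (Num.min (tau1 - tau2) (1 - tau1)))
  (resilience : Delta H A < lambda_min (gramian H (~: A))) :
  forall (n : 'I_N) (tau0 : R),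
    0 <= tau0 -> tau0 < Num.min taug (2^-1 - taug) ->
    P [set omega |
        (fun t : nat =>
           t.+1%:R `^ tau0 *
           norm2 (safe I H (decaying ca tau1) (decaying cb tau2)
                       (decaying cg taug)
                       (fun n' t' => H n' *m theta + w n' t' omega
                                     + a n' t' omega)
                       (fun t' => G t' omega) t n
                  - interest_vec I n theta)) @ \oo --> (0 : R)] = 1%E.
Proof.
move=> n tau0 tau00; rewrite lt_min => /andP[tau0g _].
move: taug_lt; rewrite !lt_min => /andP[tgh /andP[_ tgt1]].
pose y n' t' omega := H n' *m theta + w n' t' omega + a n' t' omega.
have mw n' t' i : measurable_fun setT (fun omega => w n' t' omega i 0).
  exact: (measurable_mxP (w n' t')).1 (measurable_funPT (w n' t')) i ord0.
have ma n' t' i : measurable_fun setT (fun omega => a n' t' omega i 0).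
  exact: (measurable_mxP (a n' t')).1 (measurable_funPT (a n' t')) i ord0.
have my n' t' i : measurable_fun setT (fun omega => y n' t' omega i 0).
  rewrite (_ : (fun _ => _) = fun omega => (H n' *m theta) i 0 +
    w n' t' omega i 0 + a n' t' omega i 0).
    by apply: measurable_funD => //; apply: measurable_funD.
  by apply/funext => omega; rewrite /y [LHS]mxE [in LHS]mxE.
have mG t i j : measurable (edge G t i j) by exact: (measurable_edge G_irr L_meas).
have gam0 t : 0 <= decaying cg taug t.
  by rewrite mulr_ge0 ?powR_ge0// ltW.
apply: ae_probability1.
  apply: measurable_cvg0 => t; apply: measurable_funM; first exact: measurable_cst.
  apply: (measurableT_comp (f := @Num.sqrt R)).
    by apply: continuous_measurable_fun; exact: sqrt_continuous.
  apply: measurable_sum => r; apply: measurable_funX.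
  rewrite (_ : (fun _ => _) = fun omega =>
      safe I H (decaying ca tau1) (decaying cb tau2) (decaying cg taug)
        (fun n' t' => y n' t' omega) (fun t' => G t' omega) t n r 0 -
      interest_vec I n theta r 0).
    apply: measurable_funB; last exact: measurable_cst.
    exact: measurable_safe.
  by apply/funext => omega; rewrite !mxE.
pose E i j := P (edge G 0 i j) != 0%E.
have [K K0 recur] := edges_recur G_irr L_meas L_iid.
have noise : {ae P, forall omega, forall p : 'I_(\sum_(n < N) Pd n),
    forall eta : R, 0 < eta -> \forall t \near \oo,
    `|t.+1%:R^-1 * \sum_(j < t.+1) w (tagnat.sig1 p) j omega (tagnat.sig2 p) 0|
      <= eta * ipow taug t}.
  apply: filter_forall => p.
  have unc := iid_entry_orthogonal (w_iid (tagnat.sig1 p))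
    (fun t => w_mean (tagnat.sig1 p) t (tagnat.sig2 p))
    (fun t => w_cov (tagnat.sig1 p) t (tagnat.sig2 p) (tagnat.sig2 p)).
  exact: (time_average_rate unc (ltW taug_gt0) tgh).
have D0 := Delta_ge0 H A.
have lamP (v : 'I_M -> R) : lambda_min (gramian H (~: A)) * \sum_m v m ^+ 2 <=
    \sum_(p | ~~ mem A p) (\sum_m stream_vec H p m 0 * v m) ^+ 2.
  (* [Delta] being nonnegative, the resilience condition makes [lambda_min] positive, which excludes
     its default value. *)
  have := lambda_min_rayleigh (gramian_sym H (~: A)) (le_lt_trans D0 resilience)
    (\col_m v m).
  rewrite gramian_bform bform1.
  have -> : \sum_i (\col_m v m) i 0 * (\col_m v m) i 0 = \sum_m v m ^+ 2.
    by apply: eq_bigr => m _; rewrite mxE expr2.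
  move/le_trans; apply; rewrite le_eqVlt; apply/orP; left; apply/eqP.
  apply: eq_big => [p|p _]; first by rewrite inE.
  by congr (_ ^+ 2); apply: eq_bigr => m _; rewrite [in LHS]mxE.
(* Outside three null sets, the sample path has compromised set [A], recurrent edges and averaged
   noise of the required rate; from here on it is fixed. *)
move: A_compromised recur noise; apply: filterS3 => omega compA recur noise.
pose X t n' m := coord (safe I H (decaying ca tau1) (decaying cb tau2)
  (decaying cg taug) (fun n' t' => y n' t' omega) (fun t' => G t' omega) t n') m.
have path m : m \in I n ->
    exists C, forall t, `|X t n m - theta m 0| <= C * ipow taug t.
  move=> mI.
  apply: (@resilient_path R N M _ (@tagnat.sig1 N Pd)
    (fun p m => stream_vec H p m 0) (interested I) (mem A) (fun m => theta m 0)
    X (fun t p => time_average (fun n' t' => y n' t' omega) (tagnat.sig1 p) t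
                    (tagnat.sig2 p) 0)
    (fun t => G t omega) E (fun t => K * (trunc_log 2 t).+1)%N
    ca cb cg tau1 tau2 taug (lambda_min (gramian H (~: A))) (Delta H A)) => //.
  - move=> p m'; rewrite inE => hpm; apply: I_coupling.
    apply: contraNneq hpm => /matrixP /(_ (tagnat.sig2 p) 0).
    by rewrite !mxE => ->.
  - move=> p; have := congr1 (fun x => x ^+ 2) (h_unit p).
    by rewrite expr1n sqr_l2.
  - move=> t n' m'; rewrite inE => mI'; exact: safeS_coord.
  - move=> m'; apply: connected_poincare => //; exact: L_connected.
  - by move=> t; rewrite muln_gt0 K0.
  - move=> e /trunc_log_le_ipow[C C0 hC]; exists (K%:R * C) => [|t].
      by rewrite mulr_gt0// ltr0n.
    by rewrite natrM -mulrA ler_wpM2l.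
  - move=> p pA eta eta0; apply: filterS (noise p eta eta0) => t.
    (* On this path the attack on a stream outside [A] vanishes at every time, so the averaged
       measurement is the true value plus averaged noise. *)
    have a0 t' : a (tagnat.sig1 p) t' omega (tagnat.sig2 p) 0 = 0.
      apply/eqP; apply: contraNT pA => at0.
      rewrite /= -compA inE; apply/asboolP; exists t'.
      by rewrite mxE.
    congr (`|_| <= _).
    rewrite /time_average mxE summxE.
    have -> : \sum_(j < t.+1) y (tagnat.sig1 p) j omega (tagnat.sig2 p) 0 =
        \sum_(j < t.+1) (\sum_m' stream_vec H p m' 0 * theta m' 0 +
          w (tagnat.sig1 p) j omega (tagnat.sig2 p) 0).
      apply: eq_bigr => j _; rewrite /y [LHS]mxE [in LHS]mxE a0 addr0.
      congr (_ + _); rewrite mxE; apply: eq_bigr => m' _.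
      by rewrite !mxE.
    set c := \sum_(m' < M) _; rewrite [in RHS]big_split/= sumr_const card_ord.
    rewrite -[c *+ _]mulr_natl mulrDr mulKf ?pnatr_eq0//.
    by rewrite addrAC subrr add0r.
  - move=> v B B0 vB; exact: Delta_bound.
  - by rewrite inE.
have [C hC] := choice (fun r => path (enum_val r) (enum_valP r)).
pose C' := \sum_r `|C r|.
have bound t : norm2 (safe I H (decaying ca tau1) (decaying cb tau2)
    (decaying cg taug) (fun n' t' => y n' t' omega) (fun t' => G t' omega) t n
    - interest_vec I n theta) <= C' * ipow taug t.
  apply: (le_trans (l2_le_l1 _)); rewrite /C' mulr_suml; apply: ler_sum => r _.
  have := hC r t; rewrite /X coord_enum_val => h.
  have -> : (safe I H (decaying ca tau1) (decaying cb tau2) (decaying cg taug)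
      (fun n' t' => y n' t' omega) (fun t' => G t' omega) t n
      - interest_vec I n theta) r 0 =
    safe I H (decaying ca tau1) (decaying cb tau2) (decaying cg taug)
      (fun n' t' => y n' t' omega) (fun t' => G t' omega) t n r 0
      - theta (enum_val r) 0.
    by rewrite !mxE.
  by apply: (le_trans h); rewrite ler_wpM2r ?ipow_ge0// ler_norm.
(* The error is O((t + 1)^(- taug)), so any tau0 < taug leaves a positive exponent of decay. *)
apply: (@squeeze_cvgr _ _ _ _ (cst 0) (fun t => C' * ipow (taug - tau0) t)).
- apply: nearW => t; rewrite mulr_ge0 ?powR_ge0 ?sqrtr_ge0//=.
  apply: le_trans (ler_wpM2l (powR_ge0 _ _) (bound t)) _.
  rewrite mulrCA; have -> : t.+1%:R `^ tau0 = ipow (- tau0) t by rewrite /ipow opprK.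
  by rewrite -ipowD addrC.
- exact: cvg_cst.
- rewrite -[X in _ --> X](mulr0 C'); apply: cvgMr; apply: ipow_cvg0.
  by rewrite subr_gt0.
Qed.
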